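(* Let $f_1,\dots,f_n:\mathbb{R}^p\to\mathbb{R}$ be twice differentiable, and suppose there are constants $0<\mu\le L$ and $\tilde L>0$ such that for all $i$ and all $x,\hat x\in\mathbb{R}^p$, $$\mu\|x-\hat x\|^2\le(\nabla f_i(x)-\nabla f_i(\hat x))^\top(x-\hat x)\le L\|x-\hat x\|^2,\qquad \|\nabla^2 f_i(x)-\nabla^2 f_i(\hat x)\|\le\tilde L\|x-\hat x\|.$$ Let $x^*$ be the minimizer of $f=\frac1n\sum_{i=1}^n f_i$ and let $M_i=\nabla^2 f_i(x^* )^{-1/2}$. Consider the iterates $x^t$ and the variables $z_i^t$, $B_i^t$ generated by the DAve-QN method, and its epochs $T_1<T_2<\cdots$ (all defined in the context). Then for every $r\in(0,1)$ there exist positive constants $\epsilon(r)$ and $\delta(r)$ such that the following holds. If (i) $\|x^0-x^*\|<\epsilon(r)$ and $\|B_i^0-\nabla^2 f_i(x^* )\|_{M_i}<\delta(r)$ for all $i=1,\dots,n$, and (ii) for all $i$ and $t$, $\sigma_i^t:=\max\{\|z_i^t-x^*\|,\|z_i^{t-D_i^t}-x^*\|\}<\mu/(3\tilde L)$, then $$\lim_{m\to\infty}\frac{\max_{t\in[T_{m+1},T_{m+2})}\|x^t-x^*\|}{\max_{t\in[T_m,T_{m+1})}\|x^t-x^*\|}=0$$ (where the denominators are understood to be nonzero).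
   Context: Norms: $\|\cdot\|$ is the Euclidean norm of vectors and the spectral norm of matrices; for a nonsingular symmetric matrix $M$, $\|A\|_M:=\|MAM\|_F$ (Frobenius norm). The DAve-QN method (asynchronous, one master and $n$ workers; worker $i$ owns $f_i$). Time is $t=0,1,2,\dots$. Initialization at $t=0$: a point $x^0\in\mathbb{R}^p$, symmetric positive definite matrices $B_i^0\in\mathbb{R}^{p\times p}$, and $z_i^0=x^0$ for all $i$; all workers receive $x^0$ at time $0$. At each time $t\ge1$ exactly one worker $i_t$ communicates with the master (performs an update); the order of workers is arbitrary, except that every worker communicates infinitely often. Let $i=i_t$ and let $\tau<t$ be the previous communication time of worker $i$ ($\tau=0$ if there was none). Then $$z_i^t=x^\tau,\quad s=z_i^t-z_i^{t-1},\quad y=\nabla f_i(z_i^t)-\nabla f_i(z_i^{t-1}),$$ $$B_i^t=B_i^{t-1}+\frac{yy^\top}{y^\top s}-\frac{B_i^{t-1}ss^\top B_i^{t-1}}{s^\top B_i^{t-1}s}$$ (BFGS update; if $s=0$ then $B_i^t=B_i^{t-1}$), while $z_j^t=z_j^{t-1}$, $B_j^t=B_j^{t-1}$ for $j\ne i$. The master then computes $$x^t=\Big(\sum_{j=1}^n B_j^t\Big)^{-1}\Big(\sum_{j=1}^n B_j^tz_j^t-\sum_{j=1}^n\nabla f_j(z_j^t)\Big)$$ and sends $x^t$ to worker $i_t$ (the other workers do not receive it). Delays: $t-d_i^t$ is the time of the last communication of worker $i$ at or before time $t$ ($d_i^t=0$ if $i=i_t$), and $D_i^t=d_i^t+d_i^{t-d_i^t-1}+1$,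 so $t-D_i^t$ is the time of its penultimate communication (the initial broadcast at time $0$ counts as a communication here). Thus $z_i^t=x^{t-D_i^t}$, and $z_i^{t-D_i^t}$ is the value held in $z_i$ before its last update. Quantities involving $D_i^t$ are considered once worker $i$ has performed at least one update. Epochs: $T_1=0$ and $T_{m+1}=\min\{t:\text{ every worker performed at least 2 updates on the interval }[T_m,t]\}$ (equivalently, $T_{m+1}$ is the first $t$ at which $t-D_i^t\ge T_m$ for all $i$). Intervals of $t$ are intervals of integers. *)

(* Defs.v *)
From HB Require Import structures.
From mathcomp Require Import all_boot all_order all_algebra.
From mathcomp Require Import all_classical all_reals all_analysis.
Set Implicit Arguments.
Unset Strict Implicit.
Unset Printing Implicit Defensive.
Import Order.TTheory GRing.Theory Num.Theory.
Import numFieldNormedType.Exports.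
Local Open Scope classical_set_scope.
Local Open Scope ring_scope.

Section Norms.
Variable R : realType.

Definition dotv p (u v : 'cV[R]_p) : R := (u^T *m v) 0 0.

(* The library norm `|v| on matrices is the sup norm, hence this definition. *)
Definition enorm p (v : 'cV[R]_p) : R := Num.sqrt (\sum_i v i 0 ^+ 2).

Definition frob p (A : 'M[R]_p) : R := Num.sqrt (\sum_i \sum_j A i j ^+ 2).

Definition spectral_norm p (A : 'M[R]_p) : R :=
  sup [set enorm (A *m v) | v in [set v : 'cV[R]_p | enorm v <= 1]].

Definition wnorm p (M A : 'M[R]_p) : R := frob (M *m A *m M).

Definition sym_posdef p (A : 'M[R]_p) : Prop :=
  A^T = A /\ forall v : 'cV[R]_p, v != 0 -> 0 < dotv v (A *m v).

(* For H symmetric positive definite this determines M uniquely: M = H^(-1/2). *)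
Definition is_inv_sqrt p (H M : 'M[R]_p) : Prop :=
  sym_posdef M /\ M *m M = invmx H.

End Norms.

Section Derivatives.
Variables (R : realType) (p : nat).
Implicit Types f : 'cV[R]_p -> R.

Definition grad f (x : 'cV[R]_p) : 'cV[R]_p :=
  \col_i 'D_(delta_mx i 0) f x.

Definition hess f (x : 'cV[R]_p) : 'M[R]_p :=
  \matrix_(i, j) 'D_(delta_mx j 0) (fun y => grad f y i 0) x.

Definition twice_differentiable f : Prop :=
  forall x, differentiable f x /\ differentiable (grad f) x.

End Derivatives.

(* A schedule w gives the worker w t that communicates at each time t >= 1;
   the value w 0 is never used. *)
Section Schedule.
Variables (n : nat) (w : nat -> 'I_n).

Definition infinitely_often : Prop :=
  forall (i : 'I_n) (t : nat), exists2 s : nat, (t < s)%N & w s = i.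

(* The empty maximum is 0, the time of the initial broadcast. *)
Definition last_comm (i : 'I_n) (t : nat) : nat :=
  \max_(0 <= s < t.+1 | (0 < s)%N && (w s == i)) s.

Definition delay (i : 'I_n) (t : nat) : nat := (t - last_comm i t)%N.

(* D_i^t. Meaningful only if 0 < last_comm i t, i.e. once worker i has
   performed an update; otherwise t - delay i t - 1 is truncated. *)
Definition delay2 (i : 'I_n) (t : nat) : nat :=
  (delay i t + delay i (t - delay i t - 1) + 1)%N.

(* The initial broadcast is not an update. *)
Definition updates (i : 'I_n) (a b : nat) : nat :=
  \sum_(a <= s < b.+1 | (0 < s)%N && (w s == i)) 1.

(* T is indexed from 1; T 0 is unconstrained. *)
Definition epochs (T : nat -> nat) : Prop :=
  T 1%N = 0%N /\
  forall m, (1 <= m)%N ->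
    (forall i, (2 <= updates i (T m) (T m.+1))%N) /\
    (forall t, (forall i, (2 <= updates i (T m) t)%N) -> (T m.+1 <= t)%N).

End Schedule.

Section Algorithm.
Variables (R : realType) (n p : nat).

Definition bfgs (B : 'M[R]_p) (s y : 'cV[R]_p) : 'M[R]_p :=
  if s == 0 then B else
  B + (dotv y s)^-1 *: (y *m y^T)
    - (dotv s (B *m s))^-1 *: (B *m s *m s^T *m B).

Record dave_qn (f : 'I_n -> 'cV[R]_p -> R) (w : nat -> 'I_n)
    (x0 : 'cV[R]_p) (B0 : 'I_n -> 'M[R]_p)
    (x : nat -> 'cV[R]_p) (z : 'I_n -> nat -> 'cV[R]_p)
    (B : 'I_n -> nat -> 'M[R]_p) : Prop := DaveQN {
  dave_x0 : x 0%N = x0;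
  dave_z0 : forall i, z i 0%N = x0;
  dave_B0 : forall i, B i 0%N = B0 i;
  dave_z_active : forall t i, w t.+1 = i ->
    z i t.+1 = x (last_comm w i t);
  dave_B_active : forall t i, w t.+1 = i ->
    B i t.+1 = bfgs (B i t) (z i t.+1 - z i t)
                    (grad (f i) (z i t.+1) - grad (f i) (z i t));
  dave_z_idle : forall t j, w t.+1 != j -> z j t.+1 = z j t;
  dave_B_idle : forall t j, w t.+1 != j -> B j t.+1 = B j t;
  dave_x : forall t,
    x t.+1 = invmx (\sum_j B j t.+1) *m
             (\sum_j B j t.+1 *m z j t.+1 - \sum_j grad (f j) (z j t.+1))
}.

Definition sigma (w : nat -> 'I_n) (z : 'I_n -> nat -> 'cV[R]_p)
    (xs : 'cV[R]_p) (i : 'I_n) (t : nat) : R :=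
  Num.max (enorm (z i t - xs)) (enorm (z i (t - delay2 w i t)%N - xs)).

(* Under [epochs w T] and m >= 1 the range is nonempty; the terms are
   nonnegative, so the default value 0 is harmless. *)
Definition epoch_max (x : nat -> 'cV[R]_p) (xs : 'cV[R]_p) (T : nat -> nat)
    (m : nat) : R :=
  \big[Num.max/0]_(T m <= t < T m.+1) enorm (x t - xs).

End Algorithm.

(* Main.v *)
(* Two facts, both uniform in the schedule, give the result.

   (1) Measure the distance Q of B_i to the Hessian of f_i at the current z_i in
   the Frobenius norm whitened by that same Hessian. A BFGS update with step
   s = z_i' - z_i satisfies |B_i' - B_i|^2 <= C (Q - Q' + c |s|). The target has to
   move with z_i: with weights frozen at x* the error of an update would be of order
   |z_i - x*|, which is not summable because a fast worker may update arbitrarily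
   often within one epoch.

   (2) By the secant equations, (sum_j B_j') (x' - x) = (B_i' - B_i) (z_i - x) when
   worker i is active. If p_i is the last iterate sent to worker i, the potential
   sum_i (2 |z_i - x| + 3 |p_i - x|) drops by at least |z_i - x| + |s| per step, up to
   an increase of 5 n |x' - x|. Hence while the updates are small the total variation
   of x and of all z_i is bounded by the initial potential, which in turn keeps Q,
   and so the updates, small.

   Consequently |B_i' - B_i| is square summable and tends to 0, and x tends to x*.
   At time T_{m+1} the potential only involves iterates of epoch m and the current one,
   so by (2) the variation of x after T_{m+1}, which dominates all later errors, is
   negligible compared with the maximal error of epoch m. *)
Require Import Defs.
From HB Require Import structures.
From mathcomp Require Import all_boot all_order all_algebra.
From mathcomp Require Import all_classical all_reals all_analysis.
From mathcomp Require Import ring lra.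
Set Implicit Arguments.
Unset Strict Implicit.
Unset Printing Implicit Defensive.
Import Order.TTheory GRing.Theory Num.Theory.
Import numFieldNormedType.Exports.
Local Open Scope classical_set_scope.
Local Open Scope ring_scope.

(** * Euclidean and Frobenius norms *)

Section EuclideanNorm.
Variable R : realType.

Section Vectors.
Variable p : nat.
Implicit Types u v w : 'cV[R]_p.

Lemma dotvE u v : dotv u v = \sum_i u i 0 * v i 0.
Proof. by rewrite /dotv mxE; apply: eq_bigr => i _; rewrite mxE. Qed.

Lemma dotvC u v : dotv u v = dotv v u.
Proof. by rewrite !dotvE; apply: eq_bigr => i _; rewrite mulrC. Qed.

Lemma dotvDr u v w : dotv u (v + w) = dotv u v + dotv u w.
Proof. by rewrite /dotv mulmxDr mxE. Qed.

Lemma dotvZr u a v : dotv u (a *: v) = a * dotv u v.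
Proof. by rewrite /dotv -scalemxAr mxE. Qed.

Lemma dotvNr u v : dotv u (- v) = - dotv u v.
Proof. by rewrite -scaleN1r dotvZr mulN1r. Qed.

Lemma dotvBr u v w : dotv u (v - w) = dotv u v - dotv u w.
Proof. by rewrite dotvDr dotvNr. Qed.

Lemma dotvDl u v w : dotv (u + v) w = dotv u w + dotv v w.
Proof. by rewrite !(dotvC _ w) dotvDr. Qed.

Lemma dotvZl a u v : dotv (a *: u) v = a * dotv u v.
Proof. by rewrite !(dotvC _ v) dotvZr. Qed.

Lemma dotvNl u v : dotv (- u) v = - dotv u v.
Proof. by rewrite !(dotvC _ v) dotvNr. Qed.

Lemma dotvBl u v w : dotv (u - v) w = dotv u w - dotv v w.
Proof. by rewrite !(dotvC _ w) dotvBr. Qed.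

Lemma dotv0r u : dotv u 0 = 0.
Proof. by rewrite /dotv mulmx0 mxE. Qed.

Lemma dotv_suml (I : finType) (F : I -> 'cV[R]_p) v :
  dotv (\sum_i F i) v = \sum_i dotv (F i) v.
Proof.
elim/big_ind2: _ => [|a x b y <- <-|//]; last by rewrite dotvDl.
by rewrite dotvC dotv0r.
Qed.

Definition dotvD := (dotvDl, dotvDr, dotvBl, dotvBr, dotvZl, dotvZr, dotvNl, dotvNr).

Lemma dotvv_ge0 v : 0 <= dotv v v.
Proof. by rewrite dotvE; apply: sumr_ge0 => i _; rewrite -expr2 sqr_ge0. Qed.

Lemma enormE v : enorm v = Num.sqrt (dotv v v).
Proof. by rewrite /enorm dotvE; congr Num.sqrt; apply: eq_bigr => i _; rewrite expr2. Qed.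

Lemma enorm_ge0 v : 0 <= enorm v.
Proof. exact: sqrtr_ge0. Qed.

Lemma enorm_sq v : enorm v ^+ 2 = dotv v v.
Proof. by rewrite enormE sqr_sqrtr // dotvv_ge0. Qed.

Lemma dotvv_eq0 v : (dotv v v == 0) = (v == 0).
Proof.
apply/eqP/eqP => [|->]; last by rewrite dotv0r.
rewrite dotvE => /eqP; rewrite psumr_eq0 => [|i _]; last by rewrite -expr2 sqr_ge0.
move=> /allP h; apply/colP => i; rewrite mxE.
by have := h i (mem_index_enum _); rewrite mulf_eq0 orbb => /eqP.
Qed.

Lemma enorm_eq0 v : (enorm v == 0) = (v == 0).
Proof. by rewrite -dotvv_eq0 -enorm_sq sqrf_eq0. Qed.

Lemma enorm_gt0 v : (0 < enorm v) = (v != 0).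
Proof. by rewrite lt0r enorm_ge0 andbT enorm_eq0. Qed.

Lemma enorm0 : enorm (0 : 'cV[R]_p) = 0.
Proof. by apply/eqP; rewrite enorm_eq0. Qed.

Lemma enormZ a v : enorm (a *: v) = `|a| * enorm v.
Proof.
by rewrite !enormE !dotvD mulrA -expr2 sqrtrM ?sqr_ge0// sqrtr_sqr.
Qed.

Lemma enormN v : enorm (- v) = enorm v.
Proof. by rewrite -scaleN1r enormZ normrN1 mul1r. Qed.

Lemma enorm_distC u v : enorm (u - v) = enorm (v - u).
Proof. by rewrite -opprB enormN. Qed.

(** Cauchy-Schwarz: the squared norm of [dotv v v *: u - dotv u v *: v] is [dotv v v] times the gap
    between the squares of the two sides. *)
Lemma ler_dotv u v : `|dotv u v| <= enorm u * enorm v.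
Proof.
have [->|v0] := eqVneq v 0; first by rewrite dotv0r normr0 enorm0 mulr0.
have v2 : 0 < dotv v v by rewrite lt0r dotvv_ge0 dotvv_eq0 v0.
rewrite -ler_sqr ?nnegrE ?mulr_ge0 ?enorm_ge0 // exprMn !enorm_sq.
rewrite -normrX ger0_norm ?sqr_ge0 //.
have := dotvv_ge0 (dotv v v *: u - dotv u v *: v).
rewrite !dotvD (dotvC v u) => h.
rewrite -(ler_pM2l v2) -subr_ge0; apply: le_trans h _.
by rewrite le_eqVlt; apply/orP; left; apply/eqP; ring.
Qed.

Lemma dotv_le u v : dotv u v <= enorm u * enorm v.
Proof. exact: le_trans (ler_norm _) (ler_dotv u v). Qed.

Lemma ler_enormD u v : enorm (u + v) <= enorm u + enorm v.
Proof.
rewrite -ler_sqr ?nnegrE ?addr_ge0 ?enorm_ge0 // sqrrD !enorm_sq !dotvD (dotvC v u).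
by have := dotv_le u v; lra.
Qed.

Lemma ler_enormB u v : enorm (u - v) <= enorm u + enorm v.
Proof. by rewrite -(enormN v) ler_enormD. Qed.

Lemma ler_enorm_dist w u v : enorm (u - v) <= enorm (u - w) + enorm (w - v).
Proof. by rewrite -[u - v](subrKA w) ler_enormD. Qed.

Lemma ler_enorm_sum (I : Type) (r : seq I) (P : pred I) (F : I -> 'cV[R]_p) :
  enorm (\sum_(i <- r | P i) F i) <= \sum_(i <- r | P i) enorm (F i).
Proof.
elim/big_ind2: _ => [|a x b y h k|//]; first by rewrite enorm0.
by apply: le_trans (ler_enormD _ _) _; apply: lerD.
Qed.

Lemma dotv_mulmx_tr u v (A : 'M[R]_p) : dotv (A *m u) v = dotv u (A^T *m v).
Proof. by rewrite /dotv trmx_mul mulmxA. Qed.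

End Vectors.

Section Frobenius.
Variable p : nat.
Implicit Types (A B : 'M[R]_p) (u v : 'cV[R]_p).

Definition fdot A B := \sum_i \sum_j A i j * B i j.

(** Flattening makes the Frobenius norm a Euclidean norm, from which it inherits the triangle
    inequality and Cauchy-Schwarz. *)
Let vec A : 'cV[R]_(p * p) := (mxvec A)^T.

Let fdotE A B : fdot A B = dotv (vec A) (vec B).
Proof.
rewrite dotvE (reindex (uncurry (@mxvec_index p p))) /=; last first.
  by case: (curry_mxvec_bij p p) => g h k; exists g => x _; rewrite (h, k).
rewrite /fdot pair_big; apply: eq_bigr => -[i j] _ /=.
by rewrite !mxE !mxvecE.
Qed.

Lemma frobE A : frob A = Num.sqrt (fdot A A).
Proof. by []. Qed.

Let frob_enorm A : frob A = enorm (vec A).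
Proof. by rewrite frobE fdotE enormE. Qed.

Let vecD A B : vec (A + B) = vec A + vec B.
Proof. by rewrite /vec !raddfD. Qed.

Let vecZ a A : vec (a *: A) = a *: vec A.
Proof. by rewrite /vec !linearZ. Qed.

Lemma fdotC A B : fdot A B = fdot B A.
Proof. by rewrite !fdotE dotvC. Qed.

Lemma fdotDl A B C : fdot (A + B) C = fdot A C + fdot B C.
Proof. by rewrite !fdotE vecD dotvDl. Qed.

Lemma fdotZl a A B : fdot (a *: A) B = a * fdot A B.
Proof. by rewrite !fdotE vecZ dotvZl. Qed.

Lemma fdotDr A B C : fdot A (B + C) = fdot A B + fdot A C.
Proof. by rewrite !(fdotC A) fdotDl. Qed.

Lemma fdotZr a A B : fdot A (a *: B) = a * fdot A B.
Proof. by rewrite !(fdotC A) fdotZl. Qed.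

Lemma frob_ge0 A : 0 <= frob A.
Proof. exact: sqrtr_ge0. Qed.

Lemma frob_sq A : frob A ^+ 2 = fdot A A.
Proof. by rewrite frob_enorm enorm_sq fdotE. Qed.

Lemma frobZ a A : frob (a *: A) = `|a| * frob A.
Proof. by rewrite !frob_enorm vecZ enormZ. Qed.

Lemma frobN A : frob (- A) = frob A.
Proof. by rewrite -scaleN1r frobZ normrN1 mul1r. Qed.

Lemma ler_frobD A B : frob (A + B) <= frob A + frob B.
Proof. by rewrite !frob_enorm vecD ler_enormD. Qed.

Lemma ler_frobB A B : frob (A - B) <= frob A + frob B.
Proof. by rewrite -(frobN B) ler_frobD. Qed.

Lemma frob_tr A : frob A^T = frob A.
Proof.
rewrite /frob exchange_big; congr Num.sqrt; apply: eq_bigr => i _.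
by apply: eq_bigr => j _; rewrite mxE.
Qed.

Lemma frob0 : frob (0 : 'M[R]_p) = 0.
Proof. by rewrite -(scale0r 0) frobZ normr0 mul0r. Qed.

Lemma frob_sq_col A : frob A ^+ 2 = \sum_j enorm (col j A) ^+ 2.
Proof.
rewrite frob_sq /fdot exchange_big; apply: eq_bigr => j _.
by rewrite enorm_sq dotvE; apply: eq_bigr => i _; rewrite !mxE.
Qed.

Lemma frob_sq_row A : frob A ^+ 2 = \sum_i enorm (row i A)^T ^+ 2.
Proof.
by rewrite -frob_tr frob_sq_col; apply: eq_bigr => i _; rewrite -tr_row.
Qed.

Lemma ler_enorm_mulmx A v : enorm (A *m v) <= frob A * enorm v.
Proof.
rewrite -ler_sqr ?nnegrE ?mulr_ge0 ?enorm_ge0 ?frob_ge0 // exprMn frob_sq_row.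
rewrite {1}/enorm sqr_sqrtr ?sumr_ge0 // => [|i _]; last exact: sqr_ge0.
rewrite mulr_suml; apply: ler_sum => i _.
have -> : (A *m v) i 0 = dotv (row i A)^T v.
  by rewrite /dotv trmxK -row_mul !mxE.
rewrite -exprMn -[X in X <= _]ger0_norm ?sqr_ge0 // normrX.
by rewrite ler_sqr ?nnegrE ?mulr_ge0 ?enorm_ge0 // ler_dotv.
Qed.

Lemma ler_frob_mulmx A B : frob (A *m B) <= frob A * frob B.
Proof.
rewrite -ler_sqr ?nnegrE ?mulr_ge0 ?frob_ge0 // exprMn.
rewrite (frob_sq_col (A *m B)) (frob_sq_col B) mulr_sumr; apply: ler_sum => j _.
rewrite -exprMn ler_sqr ?nnegrE ?mulr_ge0 ?enorm_ge0 ?frob_ge0 //.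
rewrite colE -mulmxA -colE; exact: ler_enorm_mulmx.
Qed.

Lemma ler_dotv_mulmx A u v : `|dotv u (A *m v)| <= frob A * enorm u * enorm v.
Proof.
apply: le_trans (ler_dotv _ _) _; rewrite (mulrC (frob A)) -mulrA.
by rewrite ler_wpM2l ?enorm_ge0 ?ler_enorm_mulmx.
Qed.

Lemma fdot_outer A u v : fdot A (u *m v^T) = dotv u (A *m v).
Proof.
rewrite dotvE; apply: eq_bigr => i _; rewrite mxE mulr_sumr.
by apply: eq_bigr => j _; rewrite mxE big_ord1 mxE; ring.
Qed.

Lemma mul_outer u v w : u *m v^T *m w = dotv v w *: u.
Proof.
by rewrite -mulmxA [v^T *m w]mx11_scalar mul_mx_scalar.
Qed.

Lemma frob_outer u v : frob (u *m v^T) = enorm u * enorm v.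
Proof.
rewrite frobE fdot_outer mul_outer dotvZr -!enorm_sq.
by rewrite mulrC -exprMn sqrtr_sqr ger0_norm // mulr_ge0 ?enorm_ge0.
Qed.

Lemma frob_sq_trmx A : frob A ^+ 2 = \tr (A^T *m A).
Proof.
rewrite frob_sq /fdot exchange_big /mxtrace; apply: eq_bigr => j _.
by rewrite mxE; apply: eq_bigr => i _; rewrite mxE.
Qed.

Lemma ler_tr_mulmx A B : `|\tr (A *m B)| <= frob A * frob B.
Proof.
have -> : \tr (A *m B) = fdot A^T B.
  rewrite /fdot exchange_big /mxtrace; apply: eq_bigr => j _.
  by rewrite mxE; apply: eq_bigr => i _; rewrite mxE.
by rewrite fdotE -(frob_tr A) !frob_enorm ler_dotv.
Qed.

Lemma spectral_norm_bound A v : enorm (A *m v) <= spectral_norm A * enorm v.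
Proof.
have [->|v0] := eqVneq v 0; first by rewrite mulmx0 enorm0 mulr0.
have vp : 0 < enorm v by rewrite enorm_gt0.
have -> : enorm (A *m v) = enorm (A *m ((enorm v)^-1 *: v)) * enorm v.
  rewrite -scalemxAr enormZ ger0_norm ?invr_ge0 ?enorm_ge0 // mulrC mulrA.
  by rewrite divff ?mul1r // gt_eqF.
rewrite ler_wpM2r ?enorm_ge0 //; apply: sup_ubound; last first.
  exists ((enorm v)^-1 *: v) => //=.
  by rewrite enormZ ger0_norm ?invr_ge0 ?enorm_ge0 // mulVf ?gt_eqF.
(* [sup] bounds a set only if that set is bounded above; the Frobenius norm provides such a
   bound. *)
exists (frob A) => _ [u /= u1 <-]; apply: le_trans (ler_enorm_mulmx _ _) _.
by rewrite ler_piMr ?frob_ge0.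
Qed.

(** Each of the [p] columns is the image of a unit vector. This would give the square root of [p];
    the cruder factor [p] avoids the root. *)
Lemma frob_le_spectral A : frob A <= p%:R * spectral_norm A.
Proof.
have h j : enorm (col j A) <= spectral_norm A.
  have e1 : enorm (delta_mx j 0 : 'cV[R]_p) = 1.
    rewrite enormE dotvE (bigD1 j) //= big1 => [|i ij].
      by rewrite !mxE !eqxx mulr1 addr0 sqrtr1.
    by rewrite !mxE (negPf ij) mul0r.
  by rewrite colE; have := spectral_norm_bound A (delta_mx j 0); rewrite e1 mulr1.
have [p0|p_gt0] := posnP p.
  have -> : frob A = 0.
    by rewrite /frob big1 ?sqrtr0 // => i; have := ltn_ord i; rewrite {2}p0.
  by rewrite (_ : p%:R = 0 :> R) ?mul0r // p0.
have s0 : 0 <= spectral_norm A.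
  by apply: le_trans (h (Ordinal p_gt0)); apply: enorm_ge0.
rewrite -ler_sqr ?nnegrE ?mulr_ge0 ?frob_ge0 // frob_sq_col exprMn.
apply: (@le_trans _ _ (\sum_(j < p) spectral_norm A ^+ 2)).
  by apply: ler_sum => j _; rewrite ler_sqr ?nnegrE ?enorm_ge0.
rewrite sumr_const card_ord -[leLHS]mulr_natl ler_wpM2r ?sqr_ge0 //.
by rewrite -natrX ler_nat; apply: leq_pmulr.
Qed.

End Frobenius.
End EuclideanNorm.

(** * Taylor estimates and symmetry of the Hessian *)

Section Calculus.
Variables (R : realType) (p : nat).
Implicit Types (x y d u v : 'cV[R]_p).

Lemma is_derive_line (F : 'cV[R]_p -> R) x d (t : R) :
  derivable F (x + t *: d) d ->
  is_derive t 1 (fun s : R => F (x + s *: d)) ('D_d F (x + t *: d)).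
Proof.
have e : (fun h : R => h^-1 *: (((fun s : R => F (x + s *: d)) \o shift t) (h *: 1)
            - F (x + t *: d)))
       = (fun h : R => h^-1 *: ((F \o shift (x + t *: d)) (h *: d) - F (x + t *: d))).
  apply/funext => h /=; congr (_ *: (F _ - _)).
  by rewrite /shift /= [h *: 1]mulr1 scalerDl addrCA.
by move=> dF; split; rewrite /derivable /derive e.
Qed.

Lemma mvt_line (F : 'cV[R]_p -> R) x d :
  (forall y, derivable F y d) ->
  exists2 c : R, 0 <= c <= 1 & F (x + d) - F x = 'D_d F (x + c *: d).
Proof.
move=> dF; pose g (s : R) := F (x + s *: d).
have dg (t : R) : is_derive t 1 g ('D_d F (x + t *: d)) by exact: is_derive_line.
have [|c c01 gE] := @MVT R g (fun t => 'D_d F (x + t *: d)) 0 1 ltr01 (fun t _ => dg t).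
  apply: continuous_subspaceT => t; apply/differentiable_continuous/derivable1_diffP.
  by case: (dg t).
exists c; first by move: c01; rewrite in_itv /= => /andP[/ltW-> /ltW->].
by move: gE; rewrite /g subr0 mulr1 scale1r scale0r addr0.
Qed.

Lemma cV_delta_sum v : v = \sum_i v i 0 *: delta_mx i 0.
Proof.
by rewrite {1}[v]matrix_sum_delta; apply: eq_bigr => i _; rewrite big_ord1.
Qed.

Lemma derive_linear_sum (F : 'cV[R]_p -> R) x d :
  differentiable F x -> 'D_d F x = \sum_j d j 0 * 'D_(delta_mx j 0) F x.
Proof.
move=> dF; rewrite deriveE // {1}(cV_delta_sum d) linear_sum.
by apply: eq_bigr => j _; rewrite linearZ deriveE.
Qed.

Lemma derive_grad (f : 'cV[R]_p -> R) x d :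
  differentiable f x -> 'D_d f x = dotv (grad f x) d.
Proof.
move=> df; rewrite derive_linear_sum // dotvE.
by apply: eq_bigr => i _; rewrite mxE mulrC.
Qed.

Lemma differentiable_dotv_grad (f : 'cV[R]_p -> R) a x :
  twice_differentiable f -> differentiable (fun y => dotv a (grad f y)) x.
Proof.
move=> hf.
have -> : (fun y => dotv a (grad f y)) = \sum_i (fun y => a i 0 *: grad f y i 0).
  apply/funext => y; rewrite dotvE fct_sumE; apply: eq_bigr => i _ //.
apply: differentiable_sum => i.
apply: differentiableZ.
apply: (@differentiable_comp _ _ _ _ (grad f) (fun N : 'cV[R]_p => N i 0)).
  by case: (hf x).
exact: differentiable_coord.
Qed.

Lemma derive_dotv_grad (f : 'cV[R]_p -> R) a x d :
  twice_differentiable f ->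
  'D_d (fun y => dotv a (grad f y)) x = dotv a (hess f x *m d).
Proof.
move=> hf.
have dgi i : differentiable (fun y => grad f y i 0) x.
  apply: (@differentiable_comp _ _ _ _ (grad f) (fun N : 'cV[R]_p => N i 0)).
    by case: (hf x).
  exact: differentiable_coord.
have -> : (fun y => dotv a (grad f y)) = \sum_i (a i 0 \*: (fun y => grad f y i 0)).
  apply/funext => y; rewrite dotvE fct_sumE; apply: eq_bigr => i _ //.
rewrite derive_sum => [|i]; last exact/derivableZ/diff_derivable.
rewrite dotvE; apply: eq_bigr => i _.
rewrite deriveZ; last exact: diff_derivable.
congr (_ * _); rewrite derive_linear_sum // mxE; apply: eq_bigr => j _.
by rewrite mxE mulrC.
Qed.

End Calculus.

(** Lets [h] tend to 0: after division by [h ^+ 2], remainders of order [h ^+ 3] disappear. *)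
Lemma ler_vanishing (R : realFieldType) (a b c : R) :
  (forall h, 0 < h -> a <= b + h * c) -> a <= b.
Proof.
move=> H; apply/ler_addgt0Pr => e e0.
have c1 : 0 < `|c| + 1 by rewrite ltr_wpDl.
apply: le_trans (H (e / (`|c| + 1)) (divr_gt0 e0 c1)) _.
rewrite lerD2l mulrAC ler_pdivrMr // ler_pM2l //.
by have := ler_norm c; lra.
Qed.

(** * Consequences of the gradient and Hessian bounds for a single function *)

Section SmoothStronglyConvex.
Variables (R : realType) (p : nat) (f : 'cV[R]_p -> R) (mu L Lt : R).
Hypothesis hf : twice_differentiable f.
Hypothesis hLt : 0 < Lt.
Hypothesis hgrad : forall x y : 'cV[R]_p,
  mu * enorm (x - y) ^+ 2 <= dotv (grad f x - grad f y) (x - y) /\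
  dotv (grad f x - grad f y) (x - y) <= L * enorm (x - y) ^+ 2.
Hypothesis hhess : forall x y : 'cV[R]_p,
  spectral_norm (hess f x - hess f y) <= Lt * enorm (x - y).
Implicit Types (x y d u v : 'cV[R]_p).

Lemma frob_hess_lip x y : frob (hess f x - hess f y) <= p%:R * Lt * enorm (x - y).
Proof.
apply: le_trans (frob_le_spectral _) _.
by rewrite -mulrA ler_wpM2l // hhess.
Qed.

(** The remainder [a] itself is taken as the fixed direction: the mean value theorem for the scalar
    function [dotv a (grad f y)] expresses [enorm a ^+ 2] as a product of [a] with a Hessian
    difference, and one factor [enorm a] cancels. *)
Lemma grad_taylor x d :
  enorm (grad f (x + d) - grad f x - hess f x *m d) <= Lt * enorm d ^+ 2.
Proof.
set a := _ - _ - _.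
have [|c /andP[c0 c1]] := @mvt_line R p (fun y => dotv a (grad f y)) x d.
  by move=> y; apply: diff_derivable; apply: differentiable_dotv_grad.
rewrite derive_dotv_grad // => E.
have aE : enorm a ^+ 2 = dotv a ((hess f (x + c *: d) - hess f x) *m d).
  by rewrite enorm_sq {2}/a mulmxBl !dotvBr E.
have [a0|an0] := eqVneq (enorm a) 0.
  by rewrite a0 mulr_ge0 ?sqr_ge0 // ltW.
have ap : 0 < enorm a by rewrite lt0r an0 enorm_ge0.
rewrite -(ler_pM2l ap) -expr2 aE; apply: le_trans (dotv_le _ _) _.
rewrite ler_pM2l //; apply: le_trans (spectral_norm_bound _ _) _.
rewrite expr2 mulrA ler_wpM2r ?enorm_ge0 //.
apply: le_trans (hhess _ _) _; rewrite ler_wpM2l ?(ltW hLt) //.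
by rewrite addrC addKr enormZ ger0_norm // ler_piMl ?enorm_ge0.
Qed.

Lemma hess_quad_taylor x v (h : R) : 0 < h ->
  `|dotv (grad f (x + h *: v) - grad f x) (h *: v) - h ^+ 2 * dotv v (hess f x *m v)|
    <= h ^+ 3 * (Lt * enorm v ^+ 3).
Proof.
move=> h0; have := grad_taylor x (h *: v); set a := _ - _ - _ => aB.
have -> : dotv (grad f (x + h *: v) - grad f x) (h *: v)
   - h ^+ 2 * dotv v (hess f x *m v) = dotv a (h *: v).
  rewrite /a (dotvBl _ (_ *m _)) -scalemxAr !dotvD.
  by rewrite (dotvC (hess f x *m v)); ring.
apply: le_trans (ler_dotv _ _) _.
apply: le_trans (ler_wpM2r (enorm_ge0 _) aB) _.
by rewrite enormZ gtr0_norm // le_eqVlt; apply/orP; left; apply/eqP; ring.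
Qed.

(** Strong monotonicity between [x] and [x + h *: v], divided by [h ^+ 2], as [h] tends to 0. *)
Lemma hess_ge x v : mu * enorm v ^+ 2 <= dotv v (hess f x *m v).
Proof.
apply: (@ler_vanishing _ _ _ (Lt * enorm v ^+ 3)) => h h0.
have [+ _] := hgrad (x + h *: v) x; rewrite (addrC _ (- x)) addKr => H.
have := hess_quad_taylor x v h0; rewrite ler_norml => /andP[_ K].
rewrite -(ler_pM2l (exprn_gt0 2 h0)).
move: H; rewrite enormZ gtr0_norm // exprMn => H.
set q := dotv v _ in K *; move: H K; set w := dotv _ _ => H K.
rewrite !exprS expr0 mulr1 in H K *; nra.
Qed.

Lemma hess_le x v : dotv v (hess f x *m v) <= L * enorm v ^+ 2.
Proof.
apply: (@ler_vanishing _ _ _ (Lt * enorm v ^+ 3)) => h h0.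
have [_ +] := hgrad (x + h *: v) x; rewrite (addrC _ (- x)) addKr => H.
have := hess_quad_taylor x v h0; rewrite ler_norml => /andP[K _].
rewrite -(ler_pM2l (exprn_gt0 2 h0)).
move: H; rewrite enormZ gtr0_norm // exprMn => H.
set q := dotv v _ in K *; move: H K; set w := dotv _ _ => H K.
rewrite !exprS expr0 mulr1 in H K *; nra.
Qed.

(* Symmetry comes from computing this symmetric expression to second order in two ways. *)
Let second_difference u v x (h : R) := f (x + h *: u + h *: v) - f (x + h *: u)
  - (f (x + h *: v) - f x).

(** The mean value theorem for [F] in direction [h *: u] leaves the difference of the gradients at
    [x + k + h *: v] and [x + k], where [k] is a multiple of [u]. Expanding both at [x] leaves
    [h *: (hess f x *m v)] and two remainders of order [h ^+ 2]. *)
Let second_difference_expansion u v x (h : R) : 0 < h ->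
  `|second_difference u v x h - h ^+ 2 * dotv u (hess f x *m v)|
     <= h ^+ 3 * (2 * Lt * enorm u * (enorm u + enorm v) ^+ 2).
Proof.
move=> h0; pose F y := f (y + h *: v) - f y.
have sh y d : (fun k : R => k^-1 *: (((fun z => f (z + h *: v)) \o shift y) (k *: d)
      - f (y + h *: v)))
    = (fun k : R => k^-1 *: ((f \o shift (y + h *: v)) (k *: d) - f (y + h *: v))).
  by apply/funext => k /=; rewrite /shift /= addrA.
have df y d : derivable f y d by apply: diff_derivable; case: (hf y).
have dsf y d : derivable (fun z => f (z + h *: v)) y d.
  by have := df (y + h *: v) d; rewrite /derivable sh.
have dfF y d : 'D_d F y = dotv (grad f (y + h *: v) - grad f y) d.
  rewrite /F deriveB // dotvBl -(derive_grad d (proj1 (hf y))).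
  by rewrite -(derive_grad d (proj1 (hf _))) [in LHS]/derive sh.
have [|c /andP[c0 c1]] := @mvt_line R p F x (h *: u).
  by move=> y; apply: derivableB.
rewrite dfF => E.
have -> : second_difference u v x h = F (x + h *: u) - F x by [].
rewrite {}E.
set k := c *: (h *: u).
have T1 := grad_taylor x (k + h *: v); have T2 := grad_taylor x k.
rewrite addrA in T1; set a := _ - _ - _ in T1; set b := _ - _ - _ in T2.
have -> : dotv (grad f (x + k + h *: v) - grad f (x + k)) (h *: u) -
    h ^+ 2 * dotv u (hess f x *m v) = dotv (a - b) (h *: u).
  have -> : grad f (x + k + h *: v) - grad f (x + k) = a - b + h *: (hess f x *m v).
    rewrite /a /b mulmxDr -(scalemxAr h).
    move: (grad f (x + k + h *: v)) (grad f (x + k)) (grad f x) (hess f x *m k)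
      (h *: (hess f x *m v)) => g1 g2 g3 H1 H2.
    by apply/colP => i; rewrite !mxE; ring.
  by rewrite !dotvD (dotvC (hess f x *m v)); ring.
apply: le_trans (ler_dotv _ _) _.
have kB : enorm k <= h * enorm u.
  by rewrite /k !enormZ ger0_norm // gtr0_norm // ler_piMl ?mulr_ge0 ?enorm_ge0 // ltW.
have kvB : enorm (k + h *: v) <= h * (enorm u + enorm v).
  apply: le_trans (ler_enormD _ _) _; rewrite enormZ gtr0_norm // mulrDr.
  exact: lerD.
have abB : enorm (a - b) <= 2 * Lt * (h * (enorm u + enorm v)) ^+ 2.
  have hu0 := mulr_ge0 (ltW h0) (enorm_ge0 u).
  have hv0 := mulr_ge0 (ltW h0) (enorm_ge0 v).
  have L0 := ltW hLt.
  apply: le_trans (ler_enormB _ _) _; rewrite -mulrA mulrDl mul1r.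
  apply: lerD; [apply: le_trans T1 _|apply: le_trans T2 _]; rewrite ler_wpM2l //.
    by rewrite ler_sqr ?nnegrE ?enorm_ge0 // mulrDr addr_ge0.
  by rewrite ler_sqr ?nnegrE ?enorm_ge0 ?mulrDr ?addr_ge0 //; lra.
apply: le_trans (ler_wpM2r (enorm_ge0 _) abB) _.
by rewrite enormZ gtr0_norm // le_eqVlt; apply/orP; left; apply/eqP; ring.
Qed.

Lemma hess_dotC x u v : dotv u (hess f x *m v) = dotv v (hess f x *m u).
Proof.
suff H u' v' : dotv u' (hess f x *m v') <= dotv v' (hess f x *m u').
  by apply/eqP; rewrite eq_le !H.
move: u' v' => {}u {}v.
apply: (@ler_vanishing _ _ _ (2 * Lt * enorm u * (enorm u + enorm v) ^+ 2
         + 2 * Lt * enorm v * (enorm v + enorm u) ^+ 2)) => h h0.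
have := second_difference_expansion u v x h0.
have := second_difference_expansion v u x h0.
have -> : second_difference v u x h = second_difference u v x h.
  by rewrite /second_difference -!addrA (addrC (h *: v)); ring.
rewrite !ler_norml => /andP[_ K1] /andP[K2 _].
rewrite -(ler_pM2l (exprn_gt0 2 h0)).
move: K1 K2; set a := dotv u _; set b := dotv v _; set c1 := 2 * _ * _ * _; set c2 := 2 * _ * _ * _.
set D := second_difference _ _ _ _.
rewrite !exprS expr0 mulr1; lra.
Qed.

Lemma hess_sym x : (hess f x)^T = hess f x.
Proof.
have entry (A : 'M[R]_p) i j : A i j = dotv (delta_mx i 0) (A *m delta_mx j 0).
  rewrite dotvE (bigD1 i) //= big1 => [|k ki]; last by rewrite mxE (negPf ki) mul0r.
  by rewrite -colE !mxE !eqxx mul1r addr0.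
by apply/matrixP => i j; rewrite mxE !entry hess_dotC.
Qed.

End SmoothStronglyConvex.

(** * The BFGS update with a moving target *)

Section BfgsNearIdentity.
Variables (R : realType) (p : nat).
Implicit Types (E B N : 'M[R]_p) (u v w s y : 'cV[R]_p).

Lemma outer_addl u v w : (u + v) *m w^T = u *m w^T + v *m w^T.
Proof. exact: mulmxDl. Qed.

Lemma outer_addr u v w : u *m (v + w)^T = u *m v^T + u *m w^T.
Proof. by rewrite raddfD mulmxDr. Qed.

(** Both rank-one terms of a BFGS update with unit step [u] have this form: [u + w] is [y] in the
    added term and [B *m u] in the subtracted one. *)
Lemma frob_ratio_outer u w : enorm u = 1 -> enorm w <= 1 / 2 ->
  frob ((1 + dotv u w)^-1 *: ((u + w) *m (u + w)^T) - u *m u^T) <= 8 * enorm w.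
Proof.
move=> u1 w2; have := ler_dotv u w; rewrite u1 mul1r.
set m := dotv u w => mB; have w0 := enorm_ge0 w.
have /andP[m1 m2] : - enorm w <= m <= enorm w by rewrite -ler_norml.
have a0 : 1 / 2 <= 1 + m by lra.
have a_gt0 : 0 < 1 + m by lra.
have -> : (1 + m)^-1 *: ((u + w) *m (u + w)^T) - u *m u^T =
    (1 + m)^-1 *: (u *m w^T + w *m u^T + w *m w^T - m *: (u *m u^T)).
  rewrite !outer_addl !outer_addr.
  move: (u *m u^T) (u *m w^T) (w *m u^T) (w *m w^T) => A1 A2 A3 A4.
  apply/matrixP => i j; rewrite !mxE; field.
  by rewrite gt_eqF.
rewrite frobZ gtr0_norm ?invr_gt0 // mulrC ler_pdivrMr //.
have K : frob (u *m w^T + w *m u^T + w *m w^T - m *: (u *m u^T))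
     <= enorm w + enorm w + enorm w * enorm w + enorm w.
  apply: le_trans (ler_frobB _ _) _; apply: lerD.
    apply: le_trans (ler_frobD _ _) _; apply: lerD; last by rewrite frob_outer.
    apply: le_trans (ler_frobD _ _) _.
    by rewrite !frob_outer u1 mul1r mulr1.
  by rewrite frobZ frob_outer u1 !mulr1.
apply: le_trans K _; nra.
Qed.

(* With [y = s], the update replaces the error matrix [E] by the one on the left. *)
Lemma bfgs_quadratic_decrease E u : E^T = E -> enorm u = 1 -> frob E <= 1 / 5 ->
  frob (E + u *m u^T - (1 + dotv u (E *m u))^-1 *:
          ((u + E *m u) *m (u + E *m u)^T)) ^+ 2
    <= frob E ^+ 2 - enorm (E *m u) ^+ 2 / 4.
Proof.
move=> Es u1 E5; set g := E *m u.
have uu : dotv u u = 1 by rewrite -enorm_sq u1 expr1n.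
set al := dotv u g; set ga := dotv g g; set ka := dotv g (E *m g).
have ug : dotv u (E *m g) = ga by rewrite -{1}Es -dotv_mulmx_tr.
have g5 : enorm g <= 1 / 5.
  by apply: le_trans (ler_enorm_mulmx _ _) _; rewrite u1 mulr1.
have /andP[al1 al2] : - enorm g <= al <= enorm g.
  by rewrite -ler_norml; have := ler_dotv u g; rewrite u1 mul1r.
have gaE : ga = enorm g ^+ 2 by rewrite enorm_sq.
have g0 := enorm_ge0 g.
have /andP[ka1 ka2] : - (ga / 5) <= ka <= ga / 5.
  rewrite -ler_norml gaE; apply: le_trans (ler_dotv_mulmx _ _ _) _.
  by rewrite -mulrA -expr2 mulrC ler_wpM2l ?sqr_ge0 //; lra.
have a_gt0 : 0 < 1 + al by lra.
rewrite !frob_sq -scaleN1r.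
have X : fdot (E + u *m u^T + -1 *: ((1 + al)^-1 *: ((u + g) *m (u + g)^T)))
   (E + u *m u^T + -1 *: ((1 + al)^-1 *: ((u + g) *m (u + g)^T)))
   = fdot E E + 1 + (1 + al)^-1 ^+ 2 * (1 + 2 * al + ga) ^+ 2 + 2 * al
     - 2 * (1 + al)^-1 * (al + 2 * ga + ka) - 2 * (1 + al)^-1 * (1 + al) ^+ 2.
  rewrite !(fdotDl, fdotDr, fdotZl, fdotZr) (fdotC (u *m u^T) E)
    (fdotC ((u + g) *m (u + g)^T) E).
  rewrite !fdot_outer !mul_outer !mulmxDr -/g !dotvD uu ug -/al -/ka (dotvC g u) -/al -/ga.
  by ring.
rewrite {}X -lerBlDl.
set F := fdot E E.
(* The term [- 2 * ga] wins: Cauchy-Schwarz gives [al ^+ 2 <= ga], and [frob E <= 1 / 5] bounds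
   [ga ^+ 2] by [ga / 25] and the term in [ka] by [12 / 25 * ga]. So the numerator is at most
   [- (12 / 25) * ga], and the denominator at most [36 / 25]. *)
have -> : F + 1 + (1 + al)^-1 ^+ 2 * (1 + 2 * al + ga) ^+ 2 + 2 * al
     - 2 * (1 + al)^-1 * (al + 2 * ga + ka) - 2 * (1 + al)^-1 * (1 + al) ^+ 2 - F
   = (al ^+ 2 + ga ^+ 2 - 2 * ga - 2 * ka * (1 + al)) / (1 + al) ^+ 2.
  by field; rewrite gt_eqF.
rewrite ler_pdivrMr ?exprn_gt0 // -gaE.
have ga0 : 0 <= ga by rewrite gaE sqr_ge0.
have ala : al ^+ 2 <= ga by rewrite gaE -[leLHS]ger0_norm ?sqr_ge0 // normrX ler_sqr ?nnegrE // ler_norml al1.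
have ga25 : ga <= 1 / 25 by rewrite gaE; nra.
have h1 : ga ^+ 2 <= ga / 25 by nra.
have h2 : - (2 * ka * (1 + al)) <= 12 / 25 * ga by nra.
have h3 : (1 + al) ^+ 2 <= 36 / 25 by nra.
nra.
Qed.

(** Both rank-one terms are homogeneous of degree 0 in the pair [(s, y)], so the step may be
    normalised to length 1. *)
Lemma bfgs_scale B s y c : c != 0 -> bfgs B (c *: s) (c *: y) = bfgs B s y.
Proof.
move=> c0; rewrite /bfgs scaler_eq0 (negPf c0) /=; case: eqVneq => // s0.
have cc : c * c != 0 by rewrite mulf_neq0.
have sc d (A : 'M[R]_p) : (c * (c * d))^-1 *: (c *: (c *: A)) = d^-1 *: A.
  by rewrite !scalerA mulrA invfM -mulrA [X in X *: _]mulrC -mulrA divff ?mulr1.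
have tr (v : 'cV[R]_p) : (c *: v)^T = c *: v^T by apply: linearZ.
by rewrite !tr -?scalemxAr -?scalemxAl -?scalemxAr -?scalemxAl !dotvD !sc.
Qed.

Lemma trmx_bfgs B s y : B^T = B -> (bfgs B s y)^T = bfgs B s y.
Proof.
move=> Bs; rewrite /bfgs; case: ifP => // _.
by rewrite raddfB raddfD /= Bs !linearZ /= !trmx_mul !trmxK Bs !mulmxA.
Qed.

(** With [g = E *m s] for a unit step [s], the update changes the matrix by at most
    [8 * (tau + enorm g)], while the error drops by at least [enorm g ^+ 2 / 2 - 8 * tau].
    Eliminating [enorm g] gives the bound, the ninth [tau] covering the square of [tau]. *)
Lemma bfgs_near_identity E s y (tau : R) : E^T = E -> frob E <= 1 / 5 ->
  s != 0 -> tau <= 1 / 2 -> enorm (y - s) <= tau * enorm s ->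
  frob (bfgs (1%:M + E) s y - (1%:M + E)) ^+ 2
    <= 256 * (frob E - frob (bfgs (1%:M + E) s y - 1%:M) + 9 * tau).
Proof.
move=> Es E5 s0 tau2 ys.
have sp : 0 < enorm s by rewrite enorm_gt0.
have c0 : (enorm s)^-1 != 0 by rewrite invr_neq0 // gt_eqF.
rewrite -(bfgs_scale _ _ _ c0).
have : enorm ((enorm s)^-1 *: s) = 1.
  by rewrite enormZ ger0_norm ?invr_ge0 ?enorm_ge0 // mulVf ?gt_eqF.
have : enorm ((enorm s)^-1 *: y - (enorm s)^-1 *: s) <= tau.
  by rewrite -scalerBr enormZ gtr0_norm ?invr_gt0 // mulrC ler_pdivrMr.
move: ((enorm s)^-1 *: s) ((enorm s)^-1 *: y) => {s0 ys sp c0} {}s {}y ys s1.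
have ss : dotv s s = 1 by rewrite -enorm_sq s1 expr1n.
have s0 : s != 0 by rewrite -enorm_eq0 s1 oner_eq0.
have [w ws yE] : exists2 w, enorm w <= tau & y = s + w.
  by exists (y - s) => //; rewrite addrC subrK.
set g := E *m s.
set Ry := (1 + dotv s w)^-1 *: ((s + w) *m (s + w)^T).
set Rg := (1 + dotv s g)^-1 *: ((s + g) *m (s + g)^T).
have bE : bfgs (1%:M + E) s y = 1%:M + E + Ry - Rg.
  rewrite /bfgs (negPf s0) yE (mulmxDl 1%:M) mul1mx -/g !dotvD ss (dotvC w).
  have -> : (s + g) *m s^T *m (1%:M + E) = (s + g) *m (s + g)^T.
    rewrite -[LHS]mulmxA mulmxDr mulmx1; congr (_ *m _).
    by rewrite [RHS]raddfD /= /g trmx_mul Es.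
  by [].
have g5 : enorm g <= frob E.
  by apply: le_trans (ler_enorm_mulmx _ _) _; rewrite s1 mulr1.
have g0 := enorm_ge0 g; have w0 := enorm_ge0 w.
have HRy : frob (Ry - s *m s^T) <= 8 * tau.
  by apply: le_trans (frob_ratio_outer s1 _) _; lra.
have HRg : frob (Rg - s *m s^T) <= 8 * enorm g.
  by apply: frob_ratio_outer => //; lra.
have H1 : frob (bfgs (1%:M + E) s y - (1%:M + E)) <= 8 * tau + 8 * enorm g.
  rewrite bE (_ : _ - _ = (Ry - s *m s^T) - (Rg - s *m s^T)).
    by apply: le_trans (ler_frobB _ _) _; apply: lerD.
  by move: (1%:M) (s *m s^T) => ? ?; apply/matrixP => i j; rewrite !mxE; ring.
have H2 : frob (bfgs (1%:M + E) s y - 1%:M) <= frob E - enorm g ^+ 2 / 2 + 8 * tau.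
  rewrite bE (_ : _ - _ = (E + s *m s^T - Rg) + (Ry - s *m s^T)); last first.
    by move: (1%:M) (s *m s^T) => ? ?; apply/matrixP => i j; rewrite !mxE; ring.
  apply: le_trans (ler_frobD _ _) _; apply: lerD => //.
  have := bfgs_quadratic_decrease Es s1 E5; rewrite -/g -/Rg.
  have E0 := frob_ge0 E; set X := frob (_ - _) => H.
  have X0 : 0 <= X by apply: frob_ge0.
  have D0 : 0 <= frob E - enorm g ^+ 2 / 2 by nra.
  (* A drop of the square by [enorm g ^+ 2 / 4] is a drop of the norm by [enorm g ^+ 2 / 2], because
     [frob E <= 1 / 4]. *)
  rewrite -ler_sqr ?nnegrE //; apply: le_trans H _; nra.
have T0 : 0 <= tau by lra.
have H3 := frob_ge0 (bfgs (1%:M + E) s y - (1%:M + E)).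
have H4 : frob (bfgs (1%:M + E) s y - (1%:M + E)) ^+ 2 <= (8 * tau + 8 * enorm g) ^+ 2.
  by rewrite ler_sqr ?nnegrE //; lra.
apply: le_trans H4 _; nra.
Qed.

End BfgsNearIdentity.

(** * Whitening by a positive definite target *)

Section WeightedDistance.
Variable R : realType.

Lemma posdef_unitmx p (A : 'M[R]_p) :
  (forall v : 'cV[R]_p, v != 0 -> 0 < dotv v (A *m v)) -> A \in unitmx.
Proof.
move=> Ap; rewrite -unitmx_tr -row_free_unit -kermx_eq0; apply/eqP/row_matrixP => i.
rewrite row0; apply/eqP; case: eqVneq => // r0.
have rK : A *m (row i (kermx A^T))^T = 0.
  by apply: trmx_inj; rewrite trmx_mul trmxK trmx0 -row_mul mulmx_ker row0.
have := Ap (row i (kermx A^T))^T; rewrite trmx_eq0 => /(_ r0).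
by rewrite rK dotv0r ltxx.
Qed.

(** Induction on the size: the Schur complement [C - a^-1 *: (b *m b^T)] is again positive definite,
    and its factor completes a block lower triangular factor of [A]. *)
Lemma cholesky p (A : 'M[R]_p) : sym_posdef A -> exists N : 'M[R]_p, A = N *m N^T.
Proof.
elim: p A => [|p IH] A [As Ap].
  by exists 0; apply/matrixP => -[].
pose A' : 'M[R]_(1 + p) := A.
pose a := A 0 0; pose b := dlsubmx A'; pose C := drsubmx A'.
have ulE : ulsubmx A' = a%:M.
  rewrite [LHS]mx11_scalar; congr (_%:M); rewrite !mxE.
  by congr (A _ _); apply/val_inj.
have urE : ursubmx A' = b^T by rewrite /b trmx_dlsub; congr ursubmx.
have AE : A' = block_mx a%:M b^T b C by rewrite -ulE -urE submxK.
have a_gt0 : 0 < a.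
  have := Ap (delta_mx 0 0); rewrite (_ : dotv _ _ = a); last first.
    rewrite dotvE (bigD1 0) //= big1 => [|k ki]; last by rewrite mxE (negPf ki) mul0r.
    by rewrite -colE !mxE !eqxx mul1r addr0.
  by apply; apply/eqP => /matrixP/(_ 0 0)/eqP; rewrite !mxE oner_eq0.
have [|N NE] := IH (C - a^-1 *: (b *m b^T)).
  split.
    rewrite raddfB /= linearZ /= trmx_mul trmxK; congr (_ - _).
    by rewrite /C trmx_drsub; congr drsubmx.
  move=> v v0.
  (* This [t] minimises the quadratic form of [A] at [(t, v)]; the minimum is the form of the Schur
     complement at [v]. *)
  pose t : R := - (a^-1 * dotv b v).
  have Ap' : forall u : 'cV_(1 + p), u != 0 -> 0 < dotv u (A' *m u) := Ap.
  have := Ap' (col_mx t%:M v).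
  have -> : dotv (col_mx t%:M v) (A' *m col_mx t%:M v)
     = dotv v ((C - a^-1 *: (b *m b^T)) *m v).
    rewrite AE mul_block_col /dotv tr_col_mx mul_row_col tr_scalar_mx.
    rewrite -!scalar_mxM mul_mx_scalar.
    have -> : b^T *m v = (dotv b v)%:M by rewrite [LHS]mx11_scalar.
    rewrite mul_scalar_mx -raddfD /= scale_scalar_mx.
    rewrite mulmxDr mulmxBl mulmxBr -scalemxAl -!scalemxAr mul_outer.
    rewrite -scalemxAr !mxE eqxx !mulr1n.
    have -> : \sum_j v^T 0 j * b j 0 = dotv b v by rewrite dotvC /dotv mxE.
    by rewrite /t; field; rewrite gt_eqF.
  apply; apply: contra v0 => /eqP E.
  apply/eqP; rewrite -(col_mxKd t%:M v) E.
  by apply/colP => i; rewrite !mxE.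
pose rt := Num.sqrt a.
have rt2 : rt * rt = a by rewrite -expr2 sqr_sqrtr // ltW.
have rt0 : rt != 0 by rewrite gt_eqF // sqrtr_gt0.
suff : A' = block_mx (rt%:M : 'M[R]_1) 0 (rt^-1 *: b) N
    *m (block_mx (rt%:M : 'M[R]_1) 0 (rt^-1 *: b) N)^T.
  by move=> E; exists (block_mx (rt%:M : 'M[R]_1) 0 (rt^-1 *: b) N : 'M[R]_(1 + p)).
rewrite AE tr_block_mx trmx0 mulmx_block !mulmx0 !mul0mx !addr0.
rewrite tr_scalar_mx -scalar_mxM rt2 linearZ /= -!scalemxAl -!scalemxAr mul_scalar_mx.
rewrite mul_mx_scalar !scalerA mulVf // !scale1r -NE -invfM rt2.
by congr block_mx; rewrite addrC subrK.
Qed.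

(* Any [N] with [N^T G N = 1] serves as [G^(-1/2)]: the Frobenius norm of [N^T A N] does not
   depend on the choice. The default [1%:M] is reached only if [G] is not positive definite. *)
Definition whiten p (G : 'M[R]_p) : 'M[R]_p :=
  xget 1%:M [set N : 'M[R]_p | N^T *m G *m N = 1%:M].

(** For positive definite [G] this is the weighted norm of [B - G] with weight G^(-1/2), since
    whitening turns [G] into the identity. *)
Definition wdist p (G B : 'M[R]_p) : R :=
  frob ((whiten G)^T *m B *m whiten G - 1%:M).

Lemma whitenP p (G : 'M[R]_p) : sym_posdef G ->
  (whiten G)^T *m G *m whiten G = 1%:M.
Proof.
move=> Gp; have [K GK] := cholesky Gp.
have /andP[Ku Ktu] : (K \in unitmx) && (K^T \in unitmx).
  by rewrite -unitmx_mul -GK; apply/posdef_unitmx/(proj2 Gp).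
apply: (@xgetPex _ (1%:M : 'M[R]_p) [set N : 'M[R]_p | N^T *m G *m N = 1%:M]).
exists (invmx K^T) => /=.
rewrite GK trmx_inv trmxK !mulmxA mulVmx // mul1mx mulmxV //.
Qed.

Section Whitening.
Variables (p : nat) (G N : 'M[R]_p).
Hypothesis NG : N^T *m G *m N = 1%:M.

Lemma whitening_unit : N \in unitmx.
Proof. by case/mulmx1_unit: NG. Qed.

Let Nu := whitening_unit.

Lemma whitening_target : G = (invmx N)^T *m invmx N.
Proof.
rewrite -[(invmx N)^T]mulmx1 -NG trmx_inv !mulmxA mulVmx ?unitmx_tr // mul1mx.
by rewrite -mulmxA mulmxV // mulmx1.
Qed.

Lemma unwhiten (A : 'M[R]_p) : A = (invmx N)^T *m (N^T *m A *m N) *m invmx N.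
Proof.
rewrite trmx_inv !mulmxA mulVmx ?unitmx_tr // mul1mx.
by rewrite -mulmxA mulmxV // mulmx1.
Qed.

Lemma whitenB (B : 'M[R]_p) : N^T *m B *m N - 1%:M = N^T *m (B - G) *m N.
Proof. by rewrite mulmxBr mulmxBl NG. Qed.

(** Each column of [N] has quadratic form 1 under [G], hence squared length at most [mu^-1]. *)
Lemma frob_whitening_sq mu : 0 < mu ->
  (forall v : 'cV[R]_p, mu * enorm v ^+ 2 <= dotv v (G *m v)) ->
  frob N ^+ 2 <= p%:R / mu.
Proof.
move=> mu0 Glo; rewrite frob_sq_col ler_pdivlMr // mulr_suml.
apply: (@le_trans _ _ (\sum_(j < p) 1)); last by rewrite sumr_const card_ord.
apply: ler_sum => j _; rewrite mulrC; apply: le_trans (Glo _) _.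
rewrite /dotv tr_col colE !mulmxA -row_mul -row_mul NG.
by rewrite -colE !mxE eqxx.
Qed.

(** The squared length of column [j] of the inverse is the diagonal entry [G j j]. *)
Lemma frob_unwhitening_sq L :
  (forall v : 'cV[R]_p, dotv v (G *m v) <= L * enorm v ^+ 2) ->
  frob (invmx N) ^+ 2 <= p%:R * L.
Proof.
move=> Ghi; rewrite frob_sq_col.
apply: (@le_trans _ _ (\sum_(j < p) L)); last by rewrite sumr_const card_ord mulr_natl.
apply: ler_sum => j _.
have e1 : enorm (delta_mx j 0 : 'cV[R]_p) = 1.
  rewrite enormE dotvE (bigD1 j) //= big1 => [|i ij].
    by rewrite !mxE !eqxx mulr1 addr0 sqrtr1.
  by rewrite !mxE (negPf ij) mul0r.
have := Ghi (delta_mx j 0); rewrite e1 expr1n mulr1 enorm_sq; apply: le_trans.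
by rewrite colE dotv_mulmx_tr mulmxA -whitening_target.
Qed.

(** BFGS commutes with linear changes of variables, steps and gradients transforming dually. This
    reduces any target to the identity. *)
Lemma bfgs_whitened (B : 'M[R]_p) (s y : 'cV[R]_p) :
  bfgs (N^T *m B *m N) (invmx N *m s) (N^T *m y) = N^T *m bfgs B s y *m N.
Proof.
rewrite /bfgs.
have -> : (invmx N *m s == 0) = (s == 0).
  apply/eqP/eqP => [E|->]; last by rewrite mulmx0.
  by rewrite -[s]mul1mx -(mulmxV Nu) -mulmxA E mulmx0.
case: ifP => // _.
rewrite mulmxBr mulmxDr mulmxBl mulmxDl -!scalemxAr -!scalemxAl.
have -> : N^T *m B *m N *m (invmx N *m s) = N^T *m (B *m s).
  by rewrite -!mulmxA (mulmxA N) mulmxV // mul1mx.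
have dot a : dotv (invmx N *m s) (N^T *m a) = dotv s a.
  by rewrite dotv_mulmx_tr mulmxA -trmx_mul mulmxV // trmx1 mul1mx.
rewrite dotvC !dot (dotvC s).
congr (_ + _ *: _ - _ *: _); first by rewrite trmx_mul trmxK !mulmxA.
rewrite !trmx_mul !mulmxA; congr (_ *m _).
rewrite -!mulmxA; congr (_ *m (_ *m (_ *m (_ *m _)))).
by rewrite !mulmxA -trmx_mul mulmxV // trmx1 mul1mx.
Qed.

End Whitening.

(** A whitening is determined only up to an orthogonal factor, so [K] in [N' = N *m K] need not be
    near the identity. But [P = K *m K^T] is, being the inverse of [1%:M + Gam], and the squared
    norm of [K^T *m X *m K] is the trace of [(X *m P) *m (X *m P)]. *)
Lemma frob_retarget p (G G' N N' A : 'M[R]_p) (gam : R) :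
  N^T *m G *m N = 1%:M -> N'^T *m G' *m N' = 1%:M -> A^T = A ->
  frob (N^T *m (G' - G) *m N) <= gam -> gam <= 1 / 2 ->
  frob (N'^T *m A *m N') <= (1 + 2 * gam) * frob (N^T *m A *m N).
Proof.
move=> NG NG' As; set Gam := N^T *m _ *m N => gamB gam2.
have Nu := whitening_unit NG.
have [K N'E] : exists K, N' = N *m K.
  by exists (invmx N *m N'); rewrite mulmxA mulmxV // mul1mx.
have [X XE] : exists X, X = N^T *m A *m N by exists (N^T *m A *m N).
have [P PKK] : exists P, P = K *m K^T by exists (K *m K^T).
have hK : K^T *m ((1%:M + Gam) *m K) = 1%:M.
  have -> : 1%:M + Gam = N^T *m G' *m N by rewrite /Gam -(whitenB NG) addrC subrK.
  by rewrite -NG' N'E (trmx_mul N K) !mulmxA.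
have PE : P = 1%:M - Gam *m P.
  rewrite -(mulmx1C hK) -(mulmxA _ K) -PKK mulmxDl mul1mx addrK //.
have Xs : X^T = X by rewrite XE !trmx_mul trmxK As mulmxA.
have gam0 : 0 <= gam by apply: le_trans gamB; apply: frob_ge0.
have Pi : frob (P - 1%:M) <= 2 * gam.
  have E : P - 1%:M = - (Gam + Gam *m (P - 1%:M)).
    by rewrite mulmxBr mulmx1 [Gam + _]addrC subrK {1}PE addrC addKr.
  have := frobN (Gam + Gam *m (P - 1%:M)); rewrite -E => F.
  have H1 := ler_frobD Gam (Gam *m (P - 1%:M)).
  have H2 := ler_frob_mulmx Gam (P - 1%:M).
  have := frob_ge0 (P - 1%:M); nra.
have X0 := frob_ge0 X.
have -> : N'^T *m A *m N' = K^T *m X *m K by rewrite N'E (trmx_mul N K) XE !mulmxA.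
rewrite -XE -ler_sqr ?nnegrE ?mulr_ge0 ?frob_ge0 //; last by lra.
have -> : frob (K^T *m X *m K) ^+ 2 = \tr ((X *m P) *m (X *m P)).
  rewrite frob_sq_trmx (trmx_mul (K^T *m X) K) (trmx_mul K^T X) trmxK Xs.
  transitivity (\tr (K^T *m (X *m K *m K^T *m X *m K))); first by rewrite !mulmxA.
  by rewrite mxtrace_mulC PKK !mulmxA.
apply: le_trans (ler_norm _) _; apply: le_trans (ler_tr_mulmx _ _) _.
rewrite -expr2 ler_sqr ?nnegrE ?mulr_ge0 ?frob_ge0 //; last by lra.
have -> : X *m P = X + X *m (P - 1%:M) by rewrite mulmxBr mulmx1 addrC subrK.
apply: le_trans (ler_frobD _ _) _; rewrite mulrDl mul1r lerD2l.
by apply: le_trans (ler_frob_mulmx _ _) _; rewrite mulrC ler_wpM2r.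
Qed.

End WeightedDistance.

(** * One BFGS update while the target moves *)

Section BfgsMovingTarget.
Variables (R : realType) (p : nat).

Lemma frob_sandwich (A K : 'M[R]_p) k : frob K ^+ 2 <= k -> frob (K^T *m A *m K) <= k * frob A.
Proof.
move=> Kk; apply: le_trans (ler_frob_mulmx _ _) _.
apply: le_trans (ler_wpM2r (frob_ge0 _) (ler_frob_mulmx _ _)) _.
by rewrite frob_tr mulrAC -expr2 ler_wpM2r ?frob_ge0.
Qed.

(** The update is analysed in the whitening of the old target [G], and only the resulting error is
    transferred to [G']. A single [tau] bounds both the relative secant error and the change of
    target. *)
Lemma bfgs_retarget (G G' N N' B : 'M[R]_p) (s y : 'cV[R]_p) (nu lam tau : R) :
  N^T *m G *m N = 1%:M -> N'^T *m G' *m N' = 1%:M -> G'^T = G' -> B^T = B ->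
  frob N ^+ 2 <= nu -> frob (invmx N) ^+ 2 <= lam ->
  s != 0 -> nu * enorm (y - G *m s) <= tau * enorm s ->
  nu * frob (G' - G) <= tau -> tau <= 1 / 20 ->
  frob (N^T *m B *m N - 1%:M) <= 1 / 5 ->
  frob (bfgs B s y - B) ^+ 2 <= 256 * lam ^+ 2 *
    (frob (N^T *m B *m N - 1%:M) - frob (N'^T *m bfgs B s y *m N' - 1%:M) + 13 * tau).
Proof.
move=> NG NG' G's Bs N2 iN2 s0 yG GG tau20.
have Nu := whitening_unit NG.
have nu0 : 0 <= nu := le_trans (sqr_ge0 _) N2.
have lam0 : 0 <= lam := le_trans (sqr_ge0 _) iN2.
have tau0 : 0 <= tau := le_trans (mulr_ge0 nu0 (frob_ge0 _)) GG.
have [sh sE] : exists sh, s = N *m sh.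
  by exists (invmx N *m s); rewrite mulmxA mulmxV // mul1mx.
have shE : invmx N *m s = sh by rewrite sE mulmxA mulVmx // mul1mx.
have sh0 : sh != 0 by apply: contra s0 => /eqP E; rewrite sE E mulmx0.
have ysB : enorm (N^T *m y - sh) <= tau * enorm sh.
  have -> : N^T *m y - sh = N^T *m (y - G *m s).
    by rewrite mulmxBr {1}sE !mulmxA NG mul1mx.
  apply: le_trans (ler_enorm_mulmx _ _) _; rewrite frob_tr.
  have sB : enorm s <= frob N * enorm sh by rewrite {1}sE ler_enorm_mulmx.
  have [N0|N0] := eqVneq (frob N) 0.
    by rewrite N0 mul0r mulr_ge0 ?enorm_ge0.
  have Np : 0 < frob N by rewrite lt0r N0 frob_ge0.
  have H1 : frob N ^+ 2 * enorm (y - G *m s) <= nu * enorm (y - G *m s).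
    by rewrite ler_wpM2r ?enorm_ge0.
  have H2 : tau * enorm s <= tau * (frob N * enorm sh) by rewrite ler_wpM2l.
  rewrite -(ler_pM2l Np) mulrA -expr2 (mulrCA _ tau); lra.
have [E EE] : exists E, E = N^T *m B *m N - 1%:M by exists (N^T *m B *m N - 1%:M).
have BhE : N^T *m B *m N = 1%:M + E by rewrite EE addrC subrK.
have Es : E^T = E.
  by rewrite EE raddfB /= trmx1 !trmx_mul trmxK Bs mulmxA.
have bE := bfgs_whitened NG B s y; rewrite shE BhE in bE.
rewrite -EE => QB.
have tau2 : tau <= 1 / 2 by lra.
have := bfgs_near_identity Es QB sh0 tau2 ysB; rewrite bE.
have : (bfgs B s y)^T = bfgs B s y by apply: trmx_bfgs.
move: (bfgs B s y) => B' B's K.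
have gamB : frob (N^T *m (G' - G) *m N) <= tau.
  by apply: le_trans GG; apply: frob_sandwich.
have RT : frob (N'^T *m B' *m N' - 1%:M)
    <= (1 + 2 * tau) * (frob (N^T *m B' *m N - 1%:M) + tau).
  rewrite (whitenB NG' B') (whitenB NG B').
  apply: le_trans (frob_retarget NG NG' _ gamB tau2) _.
    by rewrite raddfB /= B's G's.
  rewrite ler_wpM2l //; first by lra.
  have -> : B' - G' = (B' - G) - (G' - G) by rewrite opprB addrA subrK.
  rewrite mulmxBr mulmxBl; apply: le_trans (ler_frobB _ _) _; exact: lerD.
have Q0 := frob_ge0 E; have Q'0 := frob_ge0 (N^T *m B' *m N - 1%:M).
have B'B : frob (B' - B) <= lam * frob (N^T *m B' *m N - (1%:M + E)).
  rewrite {1}(unwhiten NG (B' - B)) mulmxBr mulmxBl BhE.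
  exact: frob_sandwich.
have sqB : frob (B' - B) ^+ 2 <= lam ^+ 2 * frob (N^T *m B' *m N - (1%:M + E)) ^+ 2.
  by rewrite -exprMn ler_sqr ?nnegrE ?mulr_ge0 ?frob_ge0.
apply: le_trans sqB _.
rewrite (mulrC 256 (lam ^+ 2)) -[leRHS]mulrA; apply: ler_wpM2l; first exact: sqr_ge0.
have d0 := le_trans (sqr_ge0 _) K.
apply: (le_trans K); apply: ler_wpM2l => //.
move: RT Q'0 QB Q0 d0.
move: (frob (N^T *m B' *m N - 1%:M)) (frob E) (frob (N'^T *m B' *m N' - 1%:M)) => q e q'.
rewrite pmulr_rge0 // => RT Q'0 QB Q0 d0.
(* By this bound the change of target adds [tau + 2 * tau * q + 2 * tau ^+ 2], at most [4 * tau], to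
   the [9 * tau] of the fixed target. *)
have Q'1 : q <= 13 / 20 by lra.
nra.
Qed.

End BfgsMovingTarget.

(** * Whitened distance to the Hessian at a point *)

Section HessianDistance.
Variables (R : realType) (p : nat) (f : 'cV[R]_p -> R) (mu L Lt : R).
Hypothesis hf : twice_differentiable f.
Hypotheses (hmu : 0 < mu) (hL : mu <= L) (hLt : 0 < Lt).
Hypothesis hgrad : forall x y : 'cV[R]_p,
  mu * enorm (x - y) ^+ 2 <= dotv (grad f x - grad f y) (x - y) /\
  dotv (grad f x - grad f y) (x - y) <= L * enorm (x - y) ^+ 2.
Hypothesis hhess : forall x y : 'cV[R]_p,
  spectral_norm (hess f x - hess f y) <= Lt * enorm (x - y).
Implicit Types (z v : 'cV[R]_p) (B : 'M[R]_p).

Let hessge := hess_ge hf hLt hgrad hhess.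
Let hessle := hess_le hf hLt hgrad hhess.

Lemma hess_posdef z : sym_posdef (hess f z).
Proof.
split; first exact: (hess_sym hf hLt hhess z).
move=> v v0; apply: lt_le_trans (hessge z v).
by rewrite mulr_gt0 // exprn_gt0 // enorm_gt0.
Qed.

Let NG z := whitenP (hess_posdef z).
Let N z := whiten (hess f z).
Let nu := p%:R / mu.
Let lam := p%:R * L.

Let N2 z : frob (N z) ^+ 2 <= nu.
Proof. exact (frob_whitening_sq (NG z) hmu (hessge z)). Qed.

Let iN2 z : frob (invmx (N z)) ^+ 2 <= lam.
Proof. exact (frob_unwhitening_sq (NG z) (hessle z)). Qed.

Lemma wdist_ge0 (G B : 'M[R]_p) : 0 <= wdist G B.
Proof. exact: frob_ge0. Qed.

Lemma wdist_le_frob z B : wdist (hess f z) B <= nu * frob (B - hess f z).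
Proof. rewrite /wdist (whitenB (NG z)); exact: (frob_sandwich _ (N2 z)). Qed.

Lemma frob_le_wdist z B : frob (B - hess f z) <= lam * wdist (hess f z) B.
Proof.
rewrite {1}(unwhiten (NG z) (B - _)) -(whitenB (NG z)).
exact: (frob_sandwich _ (iN2 z)).
Qed.

(** With [v = N z *m u], the form at [v] is at least [4 / 5 * enorm u ^+ 2], and
    [enorm v ^+ 2 <= nu * enorm u ^+ 2]. Weakening [p] to [p.+1] keeps the denominator nonzero. *)
Lemma wdist_quad_ge z B v : wdist (hess f z) B <= 1 / 5 ->
  4 / 5 * mu / p.+1%:R * enorm v ^+ 2 <= dotv v (B *m v).
Proof.
move=> QB; have Nu := whitening_unit (NG z).
pose u := invmx (N z) *m v.
have vE : v = N z *m u by rewrite /u mulmxA mulmxV // mul1mx.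
have vu : enorm v ^+ 2 <= nu * enorm u ^+ 2.
  apply: (@le_trans _ _ (frob (N z) ^+ 2 * enorm u ^+ 2)); last first.
    by rewrite ler_wpM2r ?sqr_ge0.
  rewrite -exprMn ler_sqr ?nnegrE ?mulr_ge0 ?enorm_ge0 ?frob_ge0 //.
  by rewrite {1}vE ler_enorm_mulmx.
have -> : dotv v (B *m v) = enorm u ^+ 2
    + dotv u (((N z)^T *m B *m N z - 1%:M) *m u).
  rewrite mulmxBl mul1mx dotvBr enorm_sq addrC subrK.
  by rewrite {1}vE dotv_mulmx_tr {1}vE !mulmxA.
have := ler_dotv_mulmx ((N z)^T *m B *m N z - 1%:M) u u.
rewrite -/(wdist (hess f z) B) -mulrA -expr2 ler_norml => /andP[H0 _].
have u0 : 0 <= enorm u ^+ 2 by apply: sqr_ge0.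
have H1 : wdist (hess f z) B * enorm u ^+ 2 <= 1 / 5 * enorm u ^+ 2.
  by rewrite ler_wpM2r.
have H2 : 4 / 5 * mu / p.+1%:R * enorm v ^+ 2 <= 4 / 5 * enorm u ^+ 2.
  apply: (@le_trans _ _ (4 / 5 * mu / p.+1%:R * (nu * enorm u ^+ 2))).
    by rewrite ler_wpM2l // !mulr_ge0 ?invr_ge0 // ltW.
  have -> : 4 / 5 * mu / p.+1%:R * (nu * enorm u ^+ 2) =
      4 / 5 * enorm u ^+ 2 * (p%:R / p.+1%:R).
    by rewrite /nu; field; rewrite (gt_eqF hmu) nat1r pnatr_eq0.
  apply: ler_piMr; first by rewrite mulr_ge0 ?sqr_ge0 // divr_ge0.
  by rewrite ler_pdivrMr ?ltr0n // mul1r ler_nat.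
apply: le_trans H2 _; rewrite /N; lra.
Qed.

(** The factor [p.+1] dominates 1, needed for the secant error from [grad_taylor], and [p], needed
    for the Frobenius change of the Hessian. *)
Lemma bfgs_moving_target z z' B :
  B^T = B -> wdist (hess f z) B <= 1 / 5 ->
  nu * p.+1%:R * Lt * enorm (z' - z) <= 1 / 20 ->
  frob (bfgs B (z' - z) (grad f z' - grad f z) - B) ^+ 2 <=
  256 * lam ^+ 2 * (wdist (hess f z) B
     - wdist (hess f z') (bfgs B (z' - z) (grad f z' - grad f z))
     + 13 * (nu * p.+1%:R * Lt * enorm (z' - z))).
Proof.
move=> Bs QB.
have [/eqP|s0] := eqVneq (z' - z) 0.
  rewrite subr_eq0 => /eqP-> _.
  by rewrite /bfgs !subrr eqxx !subrr frob0 enorm0 expr0n !mulr0 add0r mulr0.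
have Lt0 := ltW hLt.
have nu0 : 0 <= nu by rewrite mulr_ge0 ?invr_ge0 // ltW.
move=> tau20.
apply: (bfgs_retarget (NG z) (NG z') (hess_sym hf hLt hhess z') Bs (N2 z) (iN2 z)) => //.
- have -> : nu * p.+1%:R * Lt * enorm (z' - z) * enorm (z' - z)
      = nu * (p.+1%:R * (Lt * enorm (z' - z) ^+ 2)) by rewrite expr2 !mulrA.
  apply: ler_wpM2l => //.
  have := grad_taylor hf hLt hhess z (z' - z); rewrite (addrC z) subrK => T.
  by apply: (le_trans T); rewrite ler_peMl ?ler1n // mulr_ge0 ?sqr_ge0.
- have -> : nu * p.+1%:R * Lt * enorm (z' - z)
      = nu * (p.+1%:R * Lt * enorm (z' - z)) by rewrite !mulrA.
  apply: ler_wpM2l => //; apply: (le_trans (frob_hess_lip hhess z' z)).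
  by rewrite ler_wpM2r ?enorm_ge0 // ler_wpM2r // ler_nat.
Qed.

End HessianDistance.

(** * Asynchronous schedules *)

Section ScheduleLemmas.
Variables (n : nat) (w : nat -> 'I_n).

Lemma last_comm0 i : last_comm w i 0 = 0%N.
Proof. by rewrite /last_comm big_mkcond big_nat1. Qed.

Lemma last_commS i t :
  last_comm w i t.+1 = if w t.+1 == i then t.+1 else last_comm w i t.
Proof.
have le s : (last_comm w i s <= s)%N.
  rewrite /last_comm big_seq_cond; apply/bigmax_leqP_seq => k _.
  by rewrite mem_index_iota => /andP[/andP[_ ks] _].
rewrite {1}/last_comm big_mkcond big_nat_recr //= -big_mkcond /= -/(last_comm w i t).
case: eqP => _; last by rewrite maxn0.
by apply/maxn_idPr/ltnW; rewrite ltnS le.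
Qed.

Lemma last_comm_le i t : (last_comm w i t <= t)%N.
Proof.
elim: t => [|t IH]; first by rewrite last_comm0.
by rewrite last_commS; case: ifP => // _; apply: leqW.
Qed.

Lemma updatesS i a b : (a <= b.+1)%N ->
  updates w i a b.+1 = (updates w i a b + (w b.+1 == i))%N.
Proof.
move=> ab; rewrite /updates big_mkcond big_nat_recr //= -big_mkcond /=.
by case: eqP.
Qed.

Lemma updates_geq i a b : (b < a)%N -> updates w i a b = 0%N.
Proof. by move=> ba; rewrite /updates big_geq. Qed.

Lemma updates00 i : updates w i 0 0 = 0%N.
Proof. by rewrite /updates big_mkcond big_nat1. Qed.

(** Time 0 never counts as an update, so an interval that contains one ends at a successor. *)
Lemma updates_case i a b : (0 < updates w i a b)%N -> exists2 b', b = b'.+1 & (a <= b'.+1)%N.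
Proof.
case: (ltnP b a) => [ba|ab]; first by rewrite updates_geq.
case: b ab => [|b] ab; first by move: ab; rewrite leqn0 => /eqP->; rewrite updates00.
by exists b.
Qed.

Lemma updates_last_comm i a b : (0 < updates w i a b)%N -> (a <= last_comm w i b)%N.
Proof.
elim: b => [|b IH] H; have [b' bE ab] := updates_case H => //.
case: bE ab H => <- ab; rewrite updatesS // last_commS.
by case: eqP => _ //; rewrite addn0; apply: IH.
Qed.

Lemma updates_ltn i a b : (1 < updates w i a b)%N -> (a < b)%N.
Proof.
move=> H; have [b' bE ab] := updates_case (ltnW H).
move: H; rewrite bE updatesS // => H; rewrite ltnS leqNgt; apply/negP => ba.
by move: H; rewrite updates_geq // add0n; case: (_ == _).
Qed.

End ScheduleLemmas.

(** * The lag potential and the total variation of the iterates *)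

Section Variation.
Variables (R : realType) (n p : nat) (w : nat -> 'I_n).
Variables (x : nat -> 'cV[R]_p) (z : 'I_n -> nat -> 'cV[R]_p).
Hypothesis z_active : forall t i, w t.+1 = i -> z i t.+1 = x (last_comm w i t).
Hypothesis z_idle : forall t j, w t.+1 != j -> z j t.+1 = z j t.

Lemma z_pending t i :
  z i t.+1 = if w t.+1 == i then x (last_comm w i t) else z i t.
Proof. by case: eqP => [/z_active//|/eqP/z_idle]. Qed.

(** The last of two updates stores the iterate received at the one before it, which lies in the
    interval as well. *)
Lemma updates_z i a b : (1 < updates w i a b)%N ->
  exists2 tau, (a <= tau < b)%N & z i b = x tau.
Proof.
elim: b => [|b IH] H; have [b' bE ab] := updates_case (ltnW H) => //.
case: bE ab H => <- ab; rewrite updatesS // z_pending.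
case: eqP => _; last by rewrite addn0 => /IH[tau /andP[? ?] ?]; exists tau => //; apply/andP; split=> //; apply: ltnW.
rewrite addn1 ltnS => H; exists (last_comm w i b) => //.
by rewrite updates_last_comm // ltnS last_comm_le.
Qed.

Definition stepsize t := enorm (x t.+1 - x t).

(** Both terms concern the active worker: the first multiplies its matrix change in the step of the
    master, the second is the motion of its target point. *)
Definition step_cost t :=
  enorm (z (w t.+1) t - x t) + enorm (z (w t.+1) t.+1 - z (w t.+1) t).

(* The weights are the smallest ones for which [lag_step] pays for the whole [step_cost]. *)
Definition lag i t :=
  2 * enorm (z i t - x t) + 3 * enorm (x (last_comm w i t) - x t).

Definition total_lag t := \sum_i lag i t.

Lemma stepsize_ge0 t : 0 <= stepsize t. Proof. exact: enorm_ge0. Qed.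

Lemma lag_ge0 i t : 0 <= lag i t.
Proof. by rewrite addr_ge0 // mulr_ge0 ?enorm_ge0. Qed.

Lemma total_lag_ge0 t : 0 <= total_lag t.
Proof. by apply: sumr_ge0 => i _; apply: lag_ge0. Qed.

Lemma step_cost_ge0 t : 0 <= step_cost t.
Proof. by rewrite addr_ge0 ?enorm_ge0. Qed.

(** For the active worker the pending iterate [P] becomes the stored one and the new pending iterate
    is the current one, so [3 * enorm (P - x t)] falls to a term with factor 2 and the old stored
    term is freed. For an idle worker both distances grow by at most the step. *)
Lemma lag_step i t :
  lag i t.+1 + (if w t.+1 == i then step_cost t else 0) <= lag i t + 5 * stepsize t.
Proof.
rewrite /lag /step_cost /stepsize last_commS z_pending.
case: eqP => [<-|_].
  rewrite z_pending eqxx subrr enorm0 mulr0 addr0.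
  move: (w t.+1) => {}i; set P := x (last_comm w i t).
  have := ler_enorm_dist (x t) P (x t.+1).
  have := ler_enorm_dist (x t) P (z i t).
  rewrite (enorm_distC (x t) (z i t)) (enorm_distC (x t) (x t.+1)).
  have := enorm_ge0 (P - x t); have := enorm_ge0 (x t.+1 - x t).
  have := enorm_ge0 (z i t - x t).
  lra.
have := ler_enorm_dist (x t) (z i t) (x t.+1).
have := ler_enorm_dist (x t) (x (last_comm w i t)) (x t.+1).
rewrite (enorm_distC (x t) (x t.+1)); lra.
Qed.

Lemma total_lag_step t :
  total_lag t.+1 + step_cost t <= total_lag t + 5 * n%:R * stepsize t.
Proof.
have -> : step_cost t = \sum_i (if w t.+1 == i then step_cost t else 0).
  by rewrite (bigD1 (w t.+1)) //= eqxx big1 ?addr0 // => i; rewrite eq_sym => /negPf->.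
have -> : 5 * n%:R * stepsize t = \sum_(i < n) 5 * stepsize t.
  by rewrite sumr_const card_ord -[RHS]mulr_natl; ring.
by rewrite -!big_split /=; apply: ler_sum => i _; apply: lag_step.
Qed.

Lemma step_cost_le_lag t : step_cost t <= total_lag t.
Proof.
apply: (@le_trans _ _ (lag (w t.+1) t)); last first.
  by rewrite /total_lag (bigD1 (w t.+1)) //= lerDl sumr_ge0 // => i _; apply: lag_ge0.
rewrite /step_cost /lag z_pending eqxx.
have := ler_enorm_dist (x t) (x (last_comm w (w t.+1) t)) (z (w t.+1) t).
rewrite (enorm_distC (x t) (z _ t)).
have := enorm_ge0 (x (last_comm w (w t.+1) t) - x t).
lra.
Qed.

Lemma budget a k :
  \sum_(s < k) step_cost (a + s) + total_lag (a + k)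
    <= total_lag a + 5 * n%:R * \sum_(s < k) stepsize (a + s).
Proof.
elim: k => [|k IH]; first by rewrite !big_ord0 addn0 mulr0 addr0 add0r.
rewrite !big_ord_recr /= addnS mulrDr.
by have := total_lag_step (a + k); lra.
Qed.

(* The sum on the right stops one step earlier than the one on the left: the cost of a step
   is already controlled before the master moves, which makes the stability induction work. *)
Lemma budget_next a k :
  \sum_(s < k.+1) step_cost (a + s)
    <= total_lag a + 5 * n%:R * \sum_(s < k) stepsize (a + s).
Proof.
apply: le_trans (budget a k); rewrite big_ord_recr /=.
by rewrite lerD2l step_cost_le_lag.
Qed.

(** The variation is at most [kap] times the costs, and these are at most the potential plus
    [5 * n%:R] times the variation. As [5 * n%:R * kap <= 1 / 2], the variation is absorbed on the
    left. *)
Lemma variation_bound a k (kap : R) : 0 <= kap -> 10 * n%:R * kap <= 1 ->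
  (forall s, (s < k)%N -> stepsize (a + s) <= kap * step_cost (a + s)) ->
  \sum_(s < k) stepsize (a + s) <= 2 * kap * total_lag a.
Proof.
move=> kap0 kapn H.
have H1 : \sum_(s < k) stepsize (a + s) <= kap * \sum_(s < k) step_cost (a + s).
  by rewrite mulr_sumr; apply: ler_sum => s _; apply: H.
have := budget a k; have := total_lag_ge0 (a + k).
set V := \sum_(_ < k) stepsize _ in H1 *; set A := \sum_(_ < k) step_cost _ in H1 *.
move=> t0 B.
have V0 : 0 <= V by apply: sumr_ge0 => s _; apply: stepsize_ge0.
have H2 : kap * A <= kap * (total_lag a + 5 * n%:R * V) by rewrite ler_wpM2l //; lra.
have H3 : 10 * n%:R * kap * V <= V by rewrite ler_piMl.
nra.
Qed.

Lemma path_length a k : enorm (x (a + k) - x a) <= \sum_(s < k) stepsize (a + s).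
Proof.
elim: k => [|k IH]; first by rewrite addn0 subrr enorm0 big_ord0.
rewrite big_ord_recr /= addnS; apply: le_trans (ler_enorm_dist (x (a + k)) _ _) _.
by rewrite addrC lerD.
Qed.

End Variation.

(** A [t0] whose partial sum is within [e] of the supremum serves tails of every length. *)
Lemma nonneg_series_tail (R : realType) (u : nat -> R) (M : R) :
  (forall s, 0 <= u s) -> (forall k, \sum_(s < k) u s <= M) ->
  forall e, 0 < e -> exists t0, forall t k, (t0 <= t)%N -> \sum_(s < k) u (t + s)%N <= e.
Proof.
move=> u0 uM e e0.
pose S := [set \sum_(s < k) u s | k in [set: nat]].
have supS : has_sup S.
  split; first by exists (\sum_(s < 0) u s); exists 0%N.
  by exists M => _ [k _ <-]; apply: uM.
have [_ [t0 _ <-] H] := sup_adherent e0 supS.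
exists t0 => t k t0t.
have : \sum_(s < t + k) u s <= sup S.
  by apply: sup_ubound; [case: supS|exists (t + k)%N].
rewrite big_split_ord /=.
have : \sum_(s < t0) u s <= \sum_(s < t) u s.
  rewrite -(subnKC t0t) big_split_ord /= lerDl; apply: sumr_ge0 => s _; exact: u0.
lra.
Qed.

(** * Stability: small updates stay small, and the steps are summable *)

Section StableRun.
Variables (R : realType) (n p : nat) (w : nat -> 'I_n).
Variables (x : nat -> 'cV[R]_p) (z : 'I_n -> nat -> 'cV[R]_p).
Hypothesis z_active : forall t i, w t.+1 = i -> z i t.+1 = x (last_comm w i t).
Hypothesis z_idle : forall t j, w t.+1 != j -> z j t.+1 = z j t.
Local Notation cost := (step_cost w x z).
Local Notation lagsum := (total_lag w x z).

Variables (d C c theta : R) (model_error update_size : nat -> R).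
Hypotheses (d_ge0 : 0 <= d) (C_gt0 : 0 < C) (c_gt0 : 0 < c).
Hypothesis model_error_ge0 : forall t, 0 <= model_error t.
Hypothesis update_size_ge0 : forall t, 0 <= update_size t.
Hypothesis update_step : forall t, model_error t <= 1 / 5 -> d * cost t <= 1 / 20 ->
  update_size t ^+ 2 <= C * (model_error t - model_error t.+1 + 13 * d * cost t).
Hypothesis stepsize_le : forall t, model_error t.+1 <= 1 / 5 -> model_error t.+2 <= 1 / 5 ->
  c * stepsize x t.+1 <= update_size t.+1 * cost t.+1.
Hypothesis theta20 : theta <= 1 / 20.
Hypothesis theta_small : C * theta <= (c / (10 * n%:R)) ^+ 2.
Hypothesis start_small : model_error 1 + 26 * d * lagsum 1 <= theta.

(** The largest factor that [variation_bound] admits. *)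
Let kap : R := (10 * n%:R)^-1.

Let n_gt0 : 0 < n%:R :> R.
Proof. by rewrite ltr0n; case: (n) (w 0) => // -[]. Qed.

Let A := lagsum 1.

Let A0 : 0 <= A. Proof. exact: total_lag_ge0. Qed.

Let dc k : 0 <= d * cost k. Proof. by rewrite mulr_ge0 ?step_cost_ge0. Qed.

Let kap0 : 0 <= kap.
Proof. by rewrite invr_ge0 mulr_ge0 // ltW. Qed.

Let kapn : 10 * n%:R * kap <= 1.
Proof. by rewrite /kap mulfV // gt_eqF // mulr_gt0. Qed.

(** The induction invariant. Time is shifted by one because [x 0] is arbitrary and satisfies no
    equation of the master. *)
Let stable k :=
  model_error k.+1 <= model_error 1 + 13 * d * \sum_(s < k) cost s.+1 /\
  forall s, (s < k)%N -> stepsize x s.+1 <= kap * cost s.+1.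

Let stable_cost k : (forall s, (s < k)%N -> stepsize x s.+1 <= kap * cost s.+1) ->
  \sum_(s < k.+1) cost s.+1 <= 2 * A.
Proof.
move=> H; have := variation_bound z_active z_idle (a := 1) kap0 kapn H.
have := budget_next z_active z_idle 1 k.
have -> : \sum_(s < k.+1) cost (1 + s) = \sum_(s < k.+1) cost s.+1 by [].
rewrite -/A; set V := \sum_(s < k) stepsize _ _ => V2 V1.
have V3 : 5 * n%:R * V <= A.
  apply: (@le_trans _ _ (5 * n%:R * (2 * kap * A))).
    by rewrite ler_wpM2l // mulr_ge0 // ltW.
  have -> : 5 * n%:R * (2 * kap * A) = 10 * n%:R * kap * A by ring.
  by rewrite ler_piMl.
lra.
Qed.

(** The costs up to and including step [k.+1] sum to at most [2 * A], which turns 13 into the 26 of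
    [start_small]. *)
Let stable_model_error k : stable k -> model_error k.+1 + 13 * d * cost k.+1 <= theta.
Proof.
case=> Q /stable_cost; rewrite big_ord_recr /= => CA.
have := ler_wpM2l d_ge0 CA; rewrite mulrDr; move: start_small Q; rewrite -/A.
lra.
Qed.

Let stable_update k : stable k -> update_size k.+1 ^+ 2 <=
  C * (model_error k.+1 - model_error k.+2 + 13 * d * cost k.+1).
Proof.
move=> st; have Qth := stable_model_error st.
have c0 := dc k.+1; have Q0 := model_error_ge0 k.+1.
have dc20 : d * cost k.+1 <= 1 / 20.
  move: Qth c0 Q0; rewrite -[13 * d * _]mulrA.
  move: theta20; move: (model_error _) (d * cost _) => m e; lra.
by apply: update_step => //; move: theta20; lra.
Qed.

(** The model error and the cost of the next step are at most [theta] together, so the next update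
    is at most [c * kap], and hence the next step at most [kap] times its cost. *)
Let stable_all k : stable k.
Proof.
elim: k => [|k st]; first by rewrite /stable big_ord0 mulr0 addr0; split.
have U := stable_update st; have Qth := stable_model_error st.
have [Q H] := st; have c0 := dc k.+1.
have Q0 := model_error_ge0 k.+1; have Q'0 := model_error_ge0 k.+2.
(* A square being nonnegative, the update bound also limits the growth of the model error. *)
have := le_trans (sqr_ge0 _) U; rewrite pmulr_rge0 // => Q'.
have us : update_size k.+1 <= c * kap.
  rewrite -ler_sqr ?nnegrE ?mulr_ge0 ?(ltW c_gt0) //.
  apply: le_trans theta_small; apply: (le_trans U).
  by rewrite ler_pM2l //; lra.
split; first by rewrite big_ord_recr /= mulrDr; lra.
move=> s; rewrite ltnS leq_eqVlt => /orP[/eqP->|]; last exact: H.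
rewrite -(ler_pM2l c_gt0) mulrA.
have Q5 : model_error k.+1 <= 1 / 5 by move: theta20; lra.
have Q5' : model_error k.+2 <= 1 / 5 by move: theta20; lra.
apply: (le_trans (stepsize_le Q5 Q5')).
by rewrite ler_wpM2r ?step_cost_ge0.
Qed.

Lemma model_error_small k : model_error k.+1 <= 1 / 5.
Proof. by have := stable_model_error (stable_all k); have := dc k.+1; move: theta20; lra. Qed.

Let steps_summable k : \sum_(s < k) stepsize x s <= stepsize x 0 + 2 * kap * A.
Proof.
case: k => [|k].
  by rewrite big_ord0 addr_ge0 ?enorm_ge0 // !mulr_ge0.
rewrite big_ord_recl; apply: lerD => //.
apply: (variation_bound z_active z_idle (a := 1) kap0 kapn) => s sk.
by case: (stable_all k) => _ /(_ s sk).
Qed.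

Let updates_summable k : \sum_(s < k) update_size s.+1 ^+ 2 <= C * theta.
Proof.
suff H : \sum_(s < k) update_size s.+1 ^+ 2 <= C *
    (model_error 1 - model_error k.+1 + 13 * d * \sum_(s < k) cost s.+1).
  apply: (le_trans H); rewrite ler_pM2l //.
  have [_ /stable_cost CA] := stable_all k.
  have {}CA : \sum_(s < k) cost s.+1 <= 2 * A.
    by apply: le_trans CA; rewrite big_ord_recr /= lerDl step_cost_ge0.
  have := ler_wpM2l d_ge0 CA; have := model_error_ge0 k.+1.
  move: start_small; rewrite -/A; lra.
elim: k => [|k IH]; first by rewrite !big_ord0 mulr0 addr0 subrr mulr0.
rewrite !big_ord_recr /=; apply: le_trans (lerD IH (stable_update (stable_all k))) _.
by rewrite -mulrDr le_eqVlt; apply/orP; left; apply/eqP; ring.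
Qed.

Lemma small_steps (e : R) : 0 < e ->
  exists t0, forall t, (t0 < t)%N -> stepsize x t <= e * cost t.
Proof.
move=> e0; have ce : 0 < c * e by rewrite mulr_gt0.
have [t0 H] := nonneg_series_tail (u := fun s => update_size s.+1 ^+ 2)
  (fun s => sqr_ge0 _) updates_summable (exprn_gt0 2 ce).
exists t0 => -[//|t]; rewrite ltnS => t0t.
(* A tail of length one is a single squared update. *)
have := H t 1%N t0t; rewrite big_ord1 addn0 ler_sqr ?nnegrE ?(ltW ce) // => us.
rewrite -(ler_pM2l c_gt0) mulrA.
apply: (le_trans (stepsize_le (model_error_small t) (model_error_small t.+1))).
by rewrite ler_wpM2r ?step_cost_ge0.
Qed.

Lemma steps_tail (e : R) : 0 < e ->
  exists t0, forall t k, (t0 <= t)%N -> \sum_(s < k) stepsize x (t + s) <= e.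
Proof. exact: (nonneg_series_tail (@stepsize_ge0 _ _ x) steps_summable). Qed.

End StableRun.

(** * Contraction over epochs *)

Section EpochConvergence.
Variables (R : realType) (n p : nat) (w : nat -> 'I_n).
Variables (x : nat -> 'cV[R]_p) (z : 'I_n -> nat -> 'cV[R]_p) (xs : 'cV[R]_p) (T : nat -> nat).
Hypothesis z_active : forall t i, w t.+1 = i -> z i t.+1 = x (last_comm w i t).
Hypothesis z_idle : forall t j, w t.+1 != j -> z j t.+1 = z j t.
Hypothesis epochsT : epochs w T.
Local Notation cost := (step_cost w x z).
Local Notation lagsum := (total_lag w x z).
Local Notation err t := (enorm (x t - xs)).

Hypothesis tail : forall e : R, 0 < e ->
  exists t0, forall t k, (t0 <= t)%N -> \sum_(s < k) stepsize x (t + s) <= e.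
Variable K : R.
Hypothesis K_ge0 : 0 <= K.
Hypothesis err_le_lag : forall t, (0 < t)%N -> lagsum t <= 1 -> err t <= K * lagsum t.

Let n_gt0 : 0 < n%:R :> R.
Proof. by rewrite ltr0n; case: (n) (w 0) => // -[]. Qed.

Lemma epoch_lt m : (0 < m)%N -> (T m < T m.+1)%N.
Proof. by move=> m0; have [/(_ (w 0%N))/updates_ltn + _] := epochsT.2 m m0. Qed.

Lemma epoch_ge m : (m <= T m.+1)%N.
Proof. by elim: m => // m IH; apply: leq_ltn_trans IH (epoch_lt _). Qed.

Lemma epoch_updates i m : (0 < m)%N -> (1 < updates w i (T m) (T m.+1))%N.
Proof. by move=> m0; case: (epochsT.2 m m0). Qed.

Lemma path_length_between a b : (a <= b)%N ->
  enorm (x b - x a) <= \sum_(s < b - a) stepsize x (a + s).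
Proof. by move=> ab; have := path_length x a (b - a); rewrite subnKC. Qed.

(** After two updates of every worker, all stored and pending iterates date from [t0] or later. *)
Lemma lag_after e t0 t : (forall i, (1 < updates w i t0 t)%N) ->
  (forall s k, (t0 <= s)%N -> \sum_(r < k) stepsize x (s + r) <= e) ->
  lagsum t <= 5 * n%:R * e.
Proof.
move=> up He.
have He' s : (t0 <= s <= t)%N -> enorm (x s - x t) <= e.
  move=> /andP[h1 h2]; rewrite enorm_distC.
  exact: le_trans (path_length_between h2) (He _ _ h1).
have -> : 5 * n%:R * e = \sum_(i < n) 5 * e.
  by rewrite sumr_const card_ord -[RHS]mulr_natl; ring.
apply: ler_sum => i _; rewrite /lag.
have [tau /andP[tau1 tau2] ->] := updates_z z_active z_idle (up i).
have l1 : (t0 <= last_comm w i t <= t)%N.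
  by rewrite last_comm_le (updates_last_comm (ltnW (up i))).
have := He' _ l1; have := He' tau; rewrite tau1 (ltnW tau2) => /(_ isT); lra.
Qed.

(** At the end of late epochs the potential is small, and it bounds the error. Capping [e1] at 1
    meets the condition of [err_le_lag]; [K + 1] is a nonzero divisor. *)
Lemma errors_vanish (e : R) a : 0 < e -> exists2 b, (a <= b)%N & err b <= e.
Proof.
move=> e0; pose e1 := Num.min 1 (e / (K + 1)).
have K1 : 0 < K + 1 by rewrite ltr_wpDl.
have e1_gt0 : 0 < e1 by rewrite lt_min ltr01 divr_gt0.
have n5 : 0 < 5 * n%:R :> R by rewrite mulr_gt0.
have [t0 H] := tail (divr_gt0 e1_gt0 n5).
pose m := maxn t0 a; exists (T m.+2).
  by rewrite (leq_trans _ (epoch_ge m.+1)) // leqW // leq_maxr.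
have lag1 : lagsum (T m.+2) <= e1.
  have -> : e1 = 5 * n%:R * (e1 / (5 * n%:R)) by rewrite mulrC divfK // gt_eqF.
  apply: (@lag_after _ (T m.+1)) => [i|s k Ts]; first exact: epoch_updates.
  by apply: H; apply: leq_trans Ts; apply: leq_trans (epoch_ge m); apply: leq_maxl.
apply: le_trans (err_le_lag _ _) _.
- by apply: leq_trans (epoch_ge m.+1).
- by apply: (le_trans lag1); rewrite ge_min lexx.
apply: (@le_trans _ _ ((K + 1) * e1)).
  by apply: ler_pM => //; [exact: total_lag_ge0|rewrite lerDl].
have : e1 <= e / (K + 1) by rewrite ge_min lexx orbT.
by rewrite ler_pdivlMr // mulrC.
Qed.

Lemma epoch_max_ge t m : (T m <= t < T m.+1)%N -> err t <= epoch_max x xs T m.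
Proof.
move=> ht; rewrite /epoch_max.
by apply: (@le_bigmax_seq _ _ _ _ _ t); rewrite ?mem_index_iota.
Qed.

Lemma epoch_max_le m c : 0 <= c ->
  (forall t, (T m <= t)%N -> err t <= c) -> epoch_max x xs T m <= c.
Proof.
move=> c0 H; rewrite /epoch_max big_seq_cond; apply: bigmax_le => // t.
by rewrite mem_index_iota andbT => /andP[/H].
Qed.

Lemma epoch_max_ge0 m : 0 <= epoch_max x xs T m.
Proof.
by rewrite /epoch_max; elim/big_ind: _ => // [a b a0 b0|t _]; rewrite ?le_max ?a0 ?enorm_ge0.
Qed.

(** All later motion is at most [2 * e * lagsum a], and it also bounds [err a], since the iterates
    approach [xs]. In terms of [E] the potential is at most [n%:R * (5 * E + 8 * err a)], whose
    second part is absorbed because [16 * n%:R * e <= 1 / 2]. *)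
Lemma epoch_contraction (e : R) t0 m : 0 < e -> 32 * n%:R * e <= 1 ->
  (forall t, (t0 < t)%N -> stepsize x t <= e * cost t) ->
  (0 < m)%N -> (t0 < T m.+1)%N ->
  epoch_max x xs T m.+1 <= 40 * n%:R * e * epoch_max x xs T m.
Proof.
move=> e0 ne He m0 t0T; pose a := T m.+1; pose E := epoch_max x xs T m.
have E0 : 0 <= E by apply: epoch_max_ge0.
have ne0 : 0 < n%:R * e by rewrite mulr_gt0.
have V k : \sum_(s < k) stepsize x (a + s) <= 2 * e * lagsum a.
  apply: (variation_bound z_active z_idle (ltW e0)); first by lra.
  by move=> s _; apply: He; apply: leq_trans t0T (leq_addr _ _).
have lagB : lagsum a <= n%:R * (5 * E + 8 * err a).
  have -> : n%:R * (5 * E + 8 * err a) = \sum_(i < n) (5 * E + 8 * err a).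
    by rewrite sumr_const card_ord mulr_natl.
  apply: ler_sum => i _;
  have [tau /andP[tau1 tau2] zE] := updates_z z_active z_idle (epoch_updates i m0).
  rewrite /lag (zE : z i a = x tau).
  have l2 : (T m <= last_comm w i a)%N by apply/updates_last_comm/ltnW/epoch_updates.
  have e1 : err tau <= E by apply: epoch_max_ge; rewrite tau1.
  (* The last communication may happen at time [a] itself, which already belongs to the next epoch;
     hence the summand [err a]. *)
  have e2 : err (last_comm w i a) <= E + err a.
    have := last_comm_le w i a; rewrite leq_eqVlt => /orP[/eqP->|l3].
      by rewrite lerDr.
    by apply: (@le_trans _ _ E); [apply: epoch_max_ge; rewrite l2|rewrite lerDl enorm_ge0].
  have := ler_enorm_dist xs (x tau) (x a).
  have := ler_enorm_dist xs (x (last_comm w i a)) (x a).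
  rewrite (enorm_distC xs (x a)); lra.
have dist b : (a <= b)%N -> enorm (x b - x a) <= 2 * e * lagsum a.
  by move=> ab; apply: le_trans (path_length_between ab) (V _).
(* Later iterates come arbitrarily close to [xs], yet none is farther than this from [x a]. *)
have erra : err a <= 2 * e * lagsum a.
  apply/ler_addgt0Pr => h h0; have [b ab bh] := errors_vanish a h0.
  have := ler_enorm_dist (x b) (x a) xs; rewrite (enorm_distC (x a) (x b)).
  have := dist b ab; lra.
have bound : 2 * e * lagsum a <= 20 * n%:R * e * E.
  have h1 : 2 * e * lagsum a <= 2 * e * (n%:R * (5 * E + 8 * err a)).
    by rewrite ler_wpM2l // mulr_ge0 // ltW.
  have h2 : 16 * (n%:R * e) * err a <= 1 / 2 * err a.
    by rewrite ler_wpM2r ?enorm_ge0 //; lra.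
  have : 2 * e * (n%:R * (5 * E + 8 * err a)) = 10 * (n%:R * e) * E + 16 * (n%:R * e) * err a.
    by ring.
  lra.
apply: epoch_max_le => [|t at_]; first by rewrite !mulr_ge0 // ltW.
have := ler_enorm_dist (x a) (x t) xs; have := dist t at_; rewrite -/E; lra.
Qed.

Hypothesis small_steps : forall e : R, 0 < e ->
  exists t0, forall t, (t0 < t)%N -> stepsize x t <= e * cost t.

Lemma epoch_ratio_cvg :
  (fun m => epoch_max x xs T m.+1 / epoch_max x xs T m) @ \oo --> (0 : R).
Proof.
apply/cvgrPdist_le => h h0.
pose e := Num.min (32 * n%:R)^-1 (h / (40 * n%:R)).
have n32 : 0 < 32 * n%:R :> R by rewrite mulr_gt0.
have n40 : 0 < 40 * n%:R :> R by rewrite mulr_gt0.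
have e0 : 0 < e by rewrite lt_min invr_gt0 n32 divr_gt0.
have ne : 32 * n%:R * e <= 1.
  by rewrite mulrC -ler_pdivlMr // div1r ge_min lexx.
have he : 40 * n%:R * e <= h.
  by rewrite mulrC -ler_pdivlMr // ge_min lexx orbT.
have [t0 H] := small_steps e0.
exists t0.+1 => // m /= t0m; rewrite sub0r normrN.
have E0 := epoch_max_ge0; rewrite ger0_norm ?divr_ge0 //.
have m0 : (0 < m)%N by apply: leq_trans t0m.
have C := epoch_contraction e0 ne H m0 (leq_trans t0m (epoch_ge m)).
have [->|Em] := eqVneq (epoch_max x xs T m) 0; first by rewrite invr0 mulr0 ltW.
rewrite ler_pdivrMr ?lt0r ?Em ?E0 //; apply: (le_trans C).
by rewrite ler_wpM2r.
Qed.

End EpochConvergence.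

(** * The DAve-QN iteration *)

Lemma sumB_single (R : zmodType) (I : finType) (F G : I -> R) (i : I) :
  (forall j, j != i -> F j = G j) -> \sum_j F j - \sum_j G j = F i - G i.
Proof.
move=> FG; rewrite -sumrB (bigD1 i) //= big1 ?addr0 // => j ji.
by rewrite FG ?subrr.
Qed.

Lemma ler_frob_dist (R : realType) p (C A B : 'M[R]_p) :
  frob (A - B) <= frob (A - C) + frob (C - B).
Proof. by rewrite -[A - B](subrKA C) ler_frobD. Qed.

Section DaveQN.
Variables (R : realType) (n p : nat) (f : 'I_n -> 'cV[R]_p -> R) (mu L Lt : R).
Variable xs : 'cV[R]_p.
Hypothesis hf : forall i, twice_differentiable (f i).
Hypotheses (p_gt0 : (0 < p)%N) (hmu : 0 < mu) (hL : mu <= L) (hLt : 0 < Lt).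
Hypothesis hgrad : forall i (x y : 'cV[R]_p),
  mu * enorm (x - y) ^+ 2 <= dotv (grad (f i) x - grad (f i) y) (x - y) /\
  dotv (grad (f i) x - grad (f i) y) (x - y) <= L * enorm (x - y) ^+ 2.
Hypothesis hhess : forall i (x y : 'cV[R]_p),
  spectral_norm (hess (f i) x - hess (f i) y) <= Lt * enorm (x - y).
Hypothesis hxs : \sum_i grad (f i) xs = 0.
Variables (w : nat -> 'I_n) (x0 : 'cV[R]_p) (B0 : 'I_n -> 'M[R]_p).
Variables (x : nat -> 'cV[R]_p) (z : 'I_n -> nat -> 'cV[R]_p) (B : 'I_n -> nat -> 'M[R]_p).
Hypothesis run : dave_qn f w x0 B0 x z B.

Let z_active := dave_z_active run.
Let z_idle := dave_z_idle run.
Local Notation cost := (step_cost w x z).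
Local Notation lagsum := (total_lag w x z).

Definition model_error t := \sum_i wdist (hess (f i) (z i t)) (B i t).

Definition update_size t := frob (B (w t.+1) t.+1 - B (w t.+1) t).

(** The defining equation of the master iterate with the matrix inverse cleared. *)
Definition balanced t :=
  \sum_j B j t *m (x t - z j t) + \sum_j grad (f j) (z j t) = 0.

Definition drift_rate : R := p%:R / mu * p.+1%:R * Lt.
Definition update_rate : R := 256 * (p%:R * L) ^+ 2.
Definition convexity : R := 4 / 5 * mu / p.+1%:R.

Lemma drift_rate_ge0 : 0 <= drift_rate.
Proof. by rewrite /drift_rate !mulr_ge0 ?invr_ge0 // ltW. Qed.

Lemma update_rate_gt0 : 0 < update_rate.
Proof.
by rewrite mulr_gt0 // exprn_gt0 // mulr_gt0 ?ltr0n // (lt_le_trans hmu).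
Qed.

Lemma convexity_gt0 : 0 < convexity.
Proof. by rewrite /convexity divr_gt0 // mulr_gt0 // divr_gt0. Qed.

Lemma wdist_le_model_error i t : wdist (hess (f i) (z i t)) (B i t) <= model_error t.
Proof.
by rewrite /model_error (bigD1 i) //= lerDl sumr_ge0 // => j _; apply: wdist_ge0.
Qed.

Lemma model_error_ge0 t : 0 <= model_error t.
Proof. by apply: sumr_ge0 => j _; apply: wdist_ge0. Qed.

Lemma update_step t :
  (forall i, (B i t)^T = B i t) -> model_error t <= 1 / 5 ->
  drift_rate * cost t <= 1 / 20 ->
  update_size t ^+ 2 <=
    update_rate * (model_error t - model_error t.+1 + 13 * drift_rate * cost t).
Proof.
move=> Bs Q5 c20; set i := w t.+1.
have -> : model_error t - model_error t.+1 =
   wdist (hess (f i) (z i t)) (B i t) - wdist (hess (f i) (z i t.+1)) (B i t.+1).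
  apply: sumB_single => j ji; have wj : w t.+1 != j by rewrite eq_sym.
  by rewrite (z_idle wj) (dave_B_idle run wj).
have zc : enorm (z i t.+1 - z i t) <= cost t by rewrite /step_cost lerDr enorm_ge0.
have d0 := drift_rate_ge0.
have zc' : drift_rate * enorm (z i t.+1 - z i t) <= drift_rate * cost t by rewrite ler_wpM2l.
have Qi : wdist (hess (f i) (z i t)) (B i t) <= 1 / 5.
  exact: le_trans (wdist_le_model_error i t) Q5.
have := bfgs_moving_target (hf i) hmu hLt (@hgrad i) (@hhess i) (Bs i) Qi (le_trans zc' c20).
rewrite -(dave_B_active run (erefl (w t.+1))) -/i => H; apply: le_trans H _.
rewrite -/update_rate -/drift_rate; apply: ler_wpM2l; first exact: ltW update_rate_gt0.
by rewrite lerD2l -mulrA ler_wpM2l.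
Qed.

Lemma sum_quad_ge t v : model_error t <= 1 / 5 ->
  convexity * enorm v ^+ 2 <= dotv v ((\sum_j B j t) *m v).
Proof.
move=> Q5; rewrite mulmx_suml dotvC dotv_suml.
have le i : convexity * enorm v ^+ 2 <= dotv (B i t *m v) v.
  rewrite dotvC; apply: (wdist_quad_ge (hf i) hmu hLt (@hgrad i) (@hhess i) (z := z i t)).
  exact: le_trans (wdist_le_model_error i t) Q5.
(* One summand suffices for the bound, and [w 0] supplies an index; the others are nonnegative. *)
rewrite (bigD1 (w 0)) //= -[leLHS]addr0; apply: lerD => //.
apply: sumr_ge0 => j _; apply: le_trans (le j).
by rewrite mulr_ge0 ?sqr_ge0 // ltW // convexity_gt0.
Qed.

Lemma balance t : model_error t.+1 <= 1 / 5 -> balanced t.+1.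
Proof.
move=> Q5; rewrite /balanced.
have Su : \sum_j B j t.+1 \in unitmx.
  apply: posdef_unitmx => v v0; apply: lt_le_trans (sum_quad_ge v Q5).
  by rewrite mulr_gt0 ?convexity_gt0 // exprn_gt0 // enorm_gt0.
under eq_bigr do rewrite mulmxBr.
rewrite sumrB -mulmx_suml (dave_x run) mulmxA mulmxV // mul1mx.
by rewrite addrAC subrK subrr.
Qed.

(** For an idle worker both sides vanish. For the active one the first BFGS denominator is positive
    by strong monotonicity, the second by [wdist_quad_ge]. *)
Lemma secant t j : model_error t <= 1 / 5 ->
  B j t.+1 *m (z j t.+1 - z j t) = grad (f j) (z j t.+1) - grad (f j) (z j t).
Proof.
move=> Q5.
have [wj|wj] := eqVneq (w t.+1) j; last first.
  by rewrite (z_idle wj) !subrr mulmx0.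
rewrite (dave_B_active run wj) /bfgs; case: eqVneq => [s0|s0].
  by rewrite s0 mulmx0; move/eqP: s0; rewrite subr_eq0 => /eqP->; rewrite subrr.
have s2 : 0 < enorm (z j t.+1 - z j t) ^+ 2 by rewrite exprn_gt0 // enorm_gt0.
have ys : dotv (grad (f j) (z j t.+1) - grad (f j) (z j t)) (z j t.+1 - z j t) != 0.
  rewrite gt_eqF //; apply: lt_le_trans (proj1 (hgrad j _ _)).
  by rewrite mulr_gt0.
have sBs : dotv (z j t.+1 - z j t) (B j t *m (z j t.+1 - z j t)) != 0.
  rewrite gt_eqF //; apply: lt_le_trans (wdist_quad_ge (hf j) hmu hLt (@hgrad j) (@hhess j)
    _ (le_trans (wdist_le_model_error j t) Q5)).
  by rewrite mulr_gt0 // convexity_gt0.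
move: (_ - _) (z j t.+1 - z j t) s2 ys sBs => y s s2 ys sBs.
rewrite mulmxBl mulmxDl -!scalemxAl -(mulmxA _ (B j t)) !mul_outer.
by rewrite !scalerA mulVf // mulVf // !scale1r addrC addrA addNr add0r.
Qed.

(* The secant equations cancel all gradient terms between two consecutive master
   steps, so that the step of the master is driven by the change of a single matrix. *)
Lemma stepsize_le_update t : balanced t -> balanced t.+1 ->
  model_error t <= 1 / 5 -> model_error t.+1 <= 1 / 5 ->
  convexity * stepsize x t <= update_size t * cost t.
Proof.
move=> b b' Q5 Q5'; set i := w t.+1.
have E : (\sum_j B j t.+1) *m (x t.+1 - x t) = (B i t.+1 - B i t) *m (z i t - x t).
  have -> : (B i t.+1 - B i t) *m (z i t - x t)
      = \sum_j (B j t.+1 - B j t) *m (z j t - x t).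
    rewrite (bigD1 i) //= big1 ?addr0 // => j ji.
    by rewrite (dave_B_idle run) ?subrr ?mul0mx // eq_sym.
  apply/eqP; rewrite -subr_eq0; apply/eqP.
  transitivity ((\sum_j B j t.+1 *m (x t.+1 - z j t.+1) + \sum_j grad (f j) (z j t.+1))
     - (\sum_j B j t *m (x t - z j t) + \sum_j grad (f j) (z j t))); last first.
    by rewrite b b' subrr.
  rewrite mulmx_suml -!big_split -!sumrB /=; apply: eq_bigr => j _.
  have := secant j Q5; rewrite !mulmxBr !mulmxBl.
  move: (B j t.+1 *m _) (B j t.+1 *m _) => a1 a2.
  move: (grad _ _) (grad _ _) => g1 g2.
  move=> /(canRL (subrK _))->.
  apply/colP => k; rewrite !mxE; ring.
have s0 : 0 <= stepsize x t by apply: enorm_ge0.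
have u0 : 0 <= update_size t by apply: frob_ge0.
have c0 : 0 <= cost t by apply: step_cost_ge0.
have [->|s_neq0] := eqVneq (stepsize x t) 0.
  by rewrite mulr0 mulr_ge0.
have s_gt0 : 0 < stepsize x t by rewrite lt0r s_neq0.
rewrite -(ler_pM2l s_gt0) mulrCA -expr2.
apply: le_trans (sum_quad_ge _ Q5') _; rewrite E; apply: le_trans (dotv_le _ _) _.
rewrite ler_wpM2l //; apply: le_trans (ler_enorm_mulmx _ _) _.
by rewrite ler_wpM2l // /step_cost lerDl enorm_ge0.
Qed.

Lemma grad_sum_monotone v :
  mu * enorm (v - xs) <= enorm (\sum_j grad (f j) v).
Proof.
have [->|v0] := eqVneq (v - xs) 0; first by rewrite enorm0 mulr0 enorm_ge0.
have vp : 0 < enorm (v - xs) by rewrite enorm_gt0.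
rewrite -(ler_pM2r vp); apply: le_trans (dotv_le _ _).
have -> : \sum_j grad (f j) v = \sum_j (grad (f j) v - grad (f j) xs).
  by rewrite sumrB hxs subr0.
rewrite dotv_suml -mulrA -expr2.
have le j := proj1 (hgrad j v xs).
rewrite (bigD1 (w 0)) //= -[leLHS]addr0; apply: lerD => //.
apply: sumr_ge0 => j _; apply: le_trans (le j).
by rewrite mulr_ge0 ?sqr_ge0 // ltW.
Qed.

(** Subtracting the balance equation writes the gradient sum at [x t] through Taylor remainders and
    the errors of the [B j t]. A lag of at most 1 makes the quadratic remainders linear. *)
Lemma error_le_lag t : balanced t -> model_error t <= 1 / 5 -> lagsum t <= 1 ->
  mu * enorm (x t - xs) <= (Lt + p%:R * L) * lagsum t.
Proof.
move=> b Q5 lag1; apply: le_trans (grad_sum_monotone _) _.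
have L0 : 0 <= p%:R * L by rewrite mulr_ge0 // (le_trans (ltW hmu)).
have lagj j : enorm (x t - z j t) <= lag w x z j t.
  rewrite /lag enorm_distC; have := enorm_ge0 (z j t - x t).
  have := enorm_ge0 (x (last_comm w j t) - x t); lra.
have -> : \sum_j grad (f j) (x t) = \sum_j (grad (f j) (x t) - grad (f j) (z j t)
     - hess (f j) (z j t) *m (x t - z j t)
     - (B j t - hess (f j) (z j t)) *m (x t - z j t)).
  transitivity (\sum_j grad (f j) (x t)
      - \sum_j (B j t *m (x t - z j t) + grad (f j) (z j t))).
    by rewrite big_split /= b subr0.
  rewrite -sumrB; apply: eq_bigr => j _.
  rewrite (mulmxBl (B j t)).
  move: (B j t *m _) (hess (f j) _ *m _) (grad (f j) (x t)) => a1 a2 g1.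
  by apply/colP => k; rewrite !mxE; ring.
apply: le_trans (ler_enorm_sum _ _ _) _.
rewrite /total_lag mulr_sumr; apply: ler_sum => j _.
apply: le_trans (ler_enormB _ _) _.
have lj1 : enorm (x t - z j t) <= 1.
  apply: le_trans (lagj j) _; apply: le_trans lag1.
  by rewrite /total_lag (bigD1 j) //= lerDl sumr_ge0 // => i _; apply: lag_ge0.
have e0 := enorm_ge0 (x t - z j t).
have Lt0 := ltW hLt.
apply: (@le_trans _ _ ((Lt + p%:R * L) * enorm (x t - z j t))); last first.
  by rewrite ler_wpM2l // addr_ge0.
rewrite mulrDl; apply: lerD.
  have := grad_taylor (hf j) hLt (@hhess j) (z j t) (x t - z j t).
  rewrite [_ + (_ - _)]addrC subrK => T; apply: (le_trans T).
  by rewrite ler_wpM2l // expr2 ler_piMl.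
apply: le_trans (ler_enorm_mulmx _ _) _; rewrite ler_wpM2r //.
apply: le_trans (frob_le_wdist (hf j) hmu hLt (@hgrad j) (@hhess j) _ _) _.
rewrite ler_piMr //.
by have := le_trans (wdist_le_model_error j t) Q5; lra.
Qed.

Lemma B_sym : (forall i, (B0 i)^T = B0 i) -> forall t i, (B i t)^T = B i t.
Proof.
move=> B0s; elim=> [|t IH] i; first by rewrite (dave_B0 run).
have [wi|wi] := eqVneq (w t.+1) i; last by rewrite (dave_B_idle run wi).
by rewrite (dave_B_active run wi) trmx_bfgs.
Qed.

Lemma first_z i : z i 1 = x0.
Proof.
by rewrite (z_pending z_active z_idle) last_comm0 (dave_x0 run) (dave_z0 run) if_same.
Qed.

(** The first active worker replaces [x0] by [x0]: the step is 0 and its matrix is kept. *)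
Lemma first_B i : B i 1 = B0 i.
Proof.
have [wi|wi] := eqVneq (w 1) i; last by rewrite (dave_B_idle run wi) (dave_B0 run).
rewrite (dave_B_active run wi) first_z (dave_z0 run) subrr /bfgs eqxx.
exact: dave_B0 run i.
Qed.

(** At time 1 the balance equation is a plain quasi-Newton step from [x0], and the gradient sum
    there is expanded at [xs]. *)
Lemma first_stepsize : model_error 1 <= 1 / 5 -> enorm (x0 - xs) <= 1 ->
  convexity * stepsize x 0 <= (\sum_j (Lt + frob (hess (f j) xs))) * enorm (x0 - xs).
Proof.
move=> Q5 e1; have e0 := enorm_ge0 (x0 - xs).
have : enorm (\sum_j grad (f j) x0)
    <= (\sum_j (Lt + frob (hess (f j) xs))) * enorm (x0 - xs).
  have -> : \sum_j grad (f j) x0 = \sum_j (grad (f j) x0 - grad (f j) xs).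
    by rewrite sumrB hxs subr0.
  apply: le_trans (ler_enorm_sum _ _ _) _; rewrite mulr_suml; apply: ler_sum => j _.
  rewrite -[X in enorm X](subrK (hess (f j) xs *m (x0 - xs))).
  apply: le_trans (ler_enormD _ _) _; rewrite mulrDl; apply: lerD; last exact: ler_enorm_mulmx.
  have := grad_taylor (hf j) hLt (@hhess j) xs (x0 - xs).
  rewrite [_ + (_ - _)]addrC subrK => H; apply: (le_trans H).
  by rewrite ler_wpM2l ?(ltW hLt) // expr2 ler_piMl.
apply: le_trans.
have E : (\sum_j B j 1) *m (x 1 - x 0) = - \sum_j grad (f j) x0.
  have := balance Q5; rewrite /balanced.
  under eq_bigr do rewrite first_z.
  rewrite [X in _ + X](eq_bigr (fun j => grad (f j) x0)) => [|j _]; last by rewrite first_z.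
  by rewrite -mulmx_suml -(dave_x0 run) => /eqP; rewrite addr_eq0 => /eqP.
have s0 : 0 <= stepsize x 0 by apply: enorm_ge0.
have [->|s_neq0] := eqVneq (stepsize x 0) 0; first by rewrite mulr0 enorm_ge0.
have s_gt0 : 0 < stepsize x 0 by rewrite lt0r s_neq0.
rewrite -(ler_pM2l s_gt0) mulrCA -expr2.
apply: le_trans (sum_quad_ge _ Q5) _; rewrite E; apply: le_trans (dotv_le _ _) _.
by rewrite enormN.
Qed.

Lemma first_lag : lagsum 1 <= 5 * n%:R * stepsize x 0.
Proof.
have -> : 5 * n%:R * stepsize x 0 = \sum_(i < n) 5 * stepsize x 0.
  by rewrite sumr_const card_ord -[RHS]mulr_natl; ring.
apply: ler_sum => i _; rewrite /lag first_z -(dave_x0 run) last_commS last_comm0.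
have s0 := enorm_ge0 (x 1 - x 0).
by rewrite /stepsize (enorm_distC (x 0)); case: ifP => _; rewrite ?subrr ?enorm0 ?(enorm_distC (x 0)); lra.
Qed.

(** The initial matrices are compared with the Hessians at [xs], after undoing the weights [M i],
    and these with the Hessians at [x0]. *)
Lemma first_model_error (M : 'I_n -> 'M[R]_p) : (forall i, M i \in unitmx) ->
  model_error 1 <= p%:R / mu * \sum_i (frob (invmx (M i)) ^+ 2 *
    wnorm (M i) (B0 i - hess (f i) xs) + p%:R * Lt * enorm (x0 - xs)).
Proof.
move=> Mu; rewrite mulr_sumr; apply: ler_sum => i _; rewrite first_z first_B.
apply: le_trans (wdist_le_frob (hf i) hmu hLt (@hgrad i) (@hhess i) _ _) _.
apply: ler_wpM2l; first by rewrite divr_ge0 // ltW.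
apply: le_trans (ler_frob_dist (hess (f i) xs) _ _) _; apply: lerD; last first.
  by rewrite enorm_distC; exact: (frob_hess_lip (@hhess i)).
move: (B0 i - hess (f i) xs) => D.
have {1}-> : D = invmx (M i) *m (M i *m D *m M i) *m invmx (M i).
  by rewrite !mulmxA mulVmx // mul1mx -mulmxA mulmxV // mulmx1.
apply: le_trans (ler_frob_mulmx _ _) _.
apply: le_trans (ler_wpM2r (frob_ge0 _) (ler_frob_mulmx _ _)) _.
by rewrite mulrAC -expr2.
Qed.

Lemma dave_qn_superlinear (T : nat -> nat) (theta : R) :
  (forall i, (B0 i)^T = B0 i) -> epochs w T ->
  theta <= 1 / 20 -> update_rate * theta <= (convexity / (10 * n%:R)) ^+ 2 ->
  model_error 1 + 26 * drift_rate * lagsum 1 <= theta ->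
  (fun m => epoch_max x xs T m.+1 / epoch_max x xs T m) @ \oo --> (0 : R).
Proof.
move=> B0s eT th20 ths start.
have us0 t : 0 <= update_size t by apply: frob_ge0.
have upd t : model_error t <= 1 / 5 -> drift_rate * cost t <= 1 / 20 ->
    update_size t ^+ 2 <=
    update_rate * (model_error t - model_error t.+1 + 13 * drift_rate * cost t).
  exact/update_step/B_sym.
have stp t : model_error t.+1 <= 1 / 5 -> model_error t.+2 <= 1 / 5 ->
    convexity * stepsize x t.+1 <= update_size t.+1 * cost t.+1.
  by move=> Q Q'; apply: stepsize_le_update => //; apply: balance.
have small k := model_error_small z_active z_idle drift_rate_ge0 update_rate_gt0
  convexity_gt0 model_error_ge0 us0 upd stp th20 ths start k.
pose K := (Lt + p%:R * L) / mu.
apply: (@epoch_ratio_cvg R n p w x z xs T z_active z_idle eT _ K).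
- exact: (steps_tail z_active z_idle drift_rate_ge0 update_rate_gt0
    convexity_gt0 model_error_ge0 us0 upd stp th20 ths start).
- rewrite divr_ge0 ?(ltW hmu) // addr_ge0 ?(ltW hLt) // mulr_ge0 //.
  exact: le_trans (ltW hmu) hL.
- move=> [//|t] _ lag1; rewrite /K mulrAC ler_pdivlMr // mulrC.
  exact: error_le_lag (balance (small t)) (small t) lag1.
- exact: (small_steps z_active z_idle drift_rate_ge0 update_rate_gt0
    convexity_gt0 model_error_ge0 us0 upd stp th20 ths start).
Qed.

End DaveQN.

(** * Optimality at the minimizer and the choice of the radii *)

Lemma grad_sum_minimizer (R : realType) (n p : nat) (f : 'I_n -> 'cV[R]_p -> R)
    (xs : 'cV[R]_p) :
  (forall i, twice_differentiable (f i)) ->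
  (forall x, \sum_i f i xs <= \sum_i f i x) -> \sum_i grad (f i) xs = 0.
Proof.
move=> hf hmin; pose F := \sum_i f i.
have df i y v : derivable (f i) y v by apply: diff_derivable; case: (hf i y).
have dF y v : derivable F y v by apply: derivable_sum.
apply/colP => j; rewrite summxE mxE; pose v : 'cV[R]_p := delta_mx j 0.
have -> : \sum_i grad (f i) xs j 0 = 'D_v F xs.
  by rewrite /F derive_sum //; apply: eq_bigr => i _; rewrite mxE.
have := @is_derive_line R p F xs v 0 (dF _ _); rewrite scale0r addr0 => dl.
have := @derive1_at_min R (fun s : R => F (xs + s *: v)) (-1) 1 0.
move=> /(_ _ _ _ _)[| | | |_ <-].
- by lra.
- by move=> t _; case: (@is_derive_line R p F xs v t (dF _ _)).
- by rewrite in_itv /=; lra.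
- by move=> t _; rewrite scale0r addr0 /F !fct_sumE.
by case: dl => _ <-.
Qed.

Theorem theorem1 (R : realType) (n p : nat) (f : 'I_n -> 'cV[R]_p -> R)
    (mu L Lt : R) (xs : 'cV[R]_p) (M : 'I_n -> 'M[R]_p)
    (hf : forall i, twice_differentiable (f i))
    (hmu : 0 < mu) (hL : mu <= L) (hLt : 0 < Lt)
    (hgrad : forall i (x y : 'cV[R]_p),
      mu * enorm (x - y) ^+ 2 <= dotv (grad (f i) x - grad (f i) y) (x - y) /\
      dotv (grad (f i) x - grad (f i) y) (x - y) <= L * enorm (x - y) ^+ 2)
    (hhess : forall i (x y : 'cV[R]_p),
      spectral_norm (hess (f i) x - hess (f i) y) <= Lt * enorm (x - y))
    (hxs : forall x : 'cV[R]_p,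
      n%:R^-1 * \sum_i f i xs <= n%:R^-1 * \sum_i f i x)
    (hM : forall i, is_inv_sqrt (hess (f i) xs) (M i)) :
  forall r : R, 0 < r -> r < 1 ->
  exists eps delta : R, 0 < eps /\ 0 < delta /\
  forall (w : nat -> 'I_n) (x0 : 'cV[R]_p) (B0 : 'I_n -> 'M[R]_p)
    (x : nat -> 'cV[R]_p) (z : 'I_n -> nat -> 'cV[R]_p)
    (B : 'I_n -> nat -> 'M[R]_p) (T : nat -> nat),
    infinitely_often w ->
    (forall i, sym_posdef (B0 i)) ->
    dave_qn f w x0 B0 x z B ->
    epochs w T ->
    enorm (x0 - xs) < eps ->
    (forall i, wnorm (M i) (B0 i - hess (f i) xs) < delta) ->
    (forall i t, (0 < last_comm w i t)%N ->
      sigma w z xs i t < mu / (3 * Lt)) ->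
    (forall m, (1 <= m)%N -> epoch_max x xs T m != 0) ->
    (fun m => epoch_max x xs T m.+1 / epoch_max x xs T m) @ \oo --> (0 : R).
Proof.
move=> r _ _.
(* Without workers there is no schedule, as [w 0] would be an element of an empty type. *)
have [n0|n_gt0] := posnP n.
  exists 1, 1; split => //; split => // w; have := ltn_ord (w 0%N).
  by rewrite [X in (_ < X)%N -> _]n0.
(* In dimension 0 all errors vanish, contrary to the nonzero denominators. *)
have [p0|p_gt0] := posnP p.
  exists 1, 1; split => //; split => // w x0 B0 x z B T _ _ _ _ _ _ _ /(_ 1%N isT)/negP[].
  have e0 (v : 'cV[R]_p) : enorm v = 0.
    by rewrite /enorm big1 ?sqrtr0 // => i; have := ltn_ord i; rewrite [X in (_ < X)%N -> _]p0.
  rewrite eq_le epoch_max_ge0 andbT; apply: epoch_max_le => // t _.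
  by rewrite e0.
have nR : 0 < n%:R :> R by rewrite ltr0n.
have gsum : \sum_i grad (f i) xs = 0.
  by apply: grad_sum_minimizer => // x; move: (hxs x); rewrite ler_pM2l ?invr_gt0.
have Mu i : M i \in unitmx by case: (hM i) => -[_ /posdef_unitmx].
pose c := convexity p mu; pose d := drift_rate p mu Lt; pose C := update_rate p L.
have c0 : 0 < c := convexity_gt0 p hmu.
have d0 : 0 <= d := drift_rate_ge0 p hmu hLt.
have C0 : 0 < C := update_rate_gt0 p_gt0 hmu hL.
pose theta := Num.min (1 / 20) ((c / (10 * n%:R)) ^+ 2 / C).
have th0 : 0 < theta.
  rewrite lt_min; apply/andP; split; first by lra.
  by rewrite divr_gt0 // exprn_gt0 // divr_gt0 // mulr_gt0.
have th20 : theta <= 1 / 20 by rewrite ge_min lexx.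
have thC : C * theta <= (c / (10 * n%:R)) ^+ 2.
  by rewrite mulrC -ler_pdivlMr // ge_min lexx orbT.
pose nu : R := p%:R / mu.
have nu0 : 0 <= nu by rewrite divr_ge0 // ltW.
pose KM := \sum_i frob (invmx (M i)) ^+ 2.
have KM0 : 0 <= KM by apply: sumr_ge0 => i _; apply: sqr_ge0.
pose K1 := \sum_i (Lt + frob (hess (f i) xs)).
have K10 : 0 <= K1.
  by apply: sumr_ge0 => i _; rewrite addr_ge0 ?frob_ge0 // ltW.
(* [U1] measures the effect of the distance from [x0] to [xs] on the initial model error, and [U2]
   its effect on [d] times the initial potential; [V] below does the same for the initial
   matrices. *)
pose U1 := nu * (n%:R * (p%:R * Lt)); pose U2 := d * (5 * n%:R * (K1 / c)).
have U10 : 0 <= U1 := mulr_ge0 nu0 (mulr_ge0 (ltW nR) (mulr_ge0 (ler0n _ _) (ltW hLt))).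
have n50 : 0 <= 5 * n%:R :> R by rewrite mulr_ge0.
have U20 : 0 <= U2 := mulr_ge0 d0 (mulr_ge0 n50 (divr_ge0 K10 (ltW c0))).
pose V := nu * KM.
have V0 : 0 <= V by rewrite mulr_ge0.
(* Each radius spends half of [theta]. The summand 1 keeps the denominators positive, and the cap at
   1 is for [first_stepsize]. *)
pose eps := Num.min 1 (theta / (2 * (U1 + 26 * U2 + 1))).
pose delta := theta / (2 * (V + 1)).
have U3 : 0 < 2 * (U1 + 26 * U2 + 1) by lra.
have V3 : 0 < 2 * (V + 1) by lra.
have eps0 : 0 < eps by rewrite lt_min ltr01 divr_gt0.
have delta0 : 0 < delta by rewrite divr_gt0.
exists eps, delta; split=> //; split=> // w x0 B0 x z B T _ B0p run eT he hdel _ _.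
have e0 := enorm_ge0 (x0 - xs).
have e1 : enorm (x0 - xs) <= 1 by apply: le_trans (ltW he) _; rewrite ge_min lexx.
have eU : enorm (x0 - xs) * (2 * (U1 + 26 * U2 + 1)) <= theta.
  by rewrite -ler_pdivlMr //; apply: le_trans (ltW he) _; rewrite ge_min lexx orbT.
have dV : delta * (2 * (V + 1)) = theta by rewrite /delta divfK // gt_eqF.
pose Q := model_error f z B.
have Q1 : Q 1%N <= V * delta + U1 * enorm (x0 - xs).
  apply: le_trans (first_model_error xs hf hmu hLt hgrad hhess run Mu) _.
  rewrite -/nu.
  have -> : V * delta + U1 * enorm (x0 - xs)
      = nu * (KM * delta + n%:R * (p%:R * Lt * enorm (x0 - xs))).
    by rewrite /V /U1; ring.
  rewrite ler_wpM2l // big_split /= sumr_const card_ord [n%:R * _]mulr_natl.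
  rewrite lerD2r mulr_suml; apply: ler_sum => i _.
  by rewrite ler_wpM2l ?sqr_ge0 // ltW.
have Vd : V * delta <= theta / 2 by move: dV; nra.
have U1e : U1 * enorm (x0 - xs) + 26 * (U2 * enorm (x0 - xs)) <= theta / 2.
  by move: eU; nra.
have U2e : 0 <= U2 * enorm (x0 - xs) by rewrite mulr_ge0.
have Q5 : Q 1%N <= 1 / 5 by move: Q1 th20; lra.
have S1 := first_stepsize hf hmu hLt hgrad hhess gsum run Q5 e1.
have S2 : stepsize x 0 <= K1 / c * enorm (x0 - xs).
  by rewrite mulrAC ler_pdivlMr // mulrC.
have S3 : d * total_lag w x z 1 <= U2 * enorm (x0 - xs).
  rewrite /U2 -mulrA ler_wpM2l //; apply: le_trans (first_lag run) _.
  by rewrite -[leRHS]mulrA ler_wpM2l // mulr_ge0.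
apply: (dave_qn_superlinear hf p_gt0 hmu hL hLt hgrad hhess gsum run _ eT th20 thC).
- by move=> i; case: (B0p i).
- rewrite -/Q -/d; move: Q1 S3; rewrite -[26 * d * _]mulrA; lra.
Qed.
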